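(* Let $X$ be a smooth complete curve over an algebraically closed field $K$ of characteristic $0$. The space $$\frac{\{\text{forms }\omega\text{ of the second kind on }X\}}{\{\text{forms }df\text{ for }f\in K(X)\}}$$ is isomorphic to $H^1_{\mathrm{dR}}(X/K)$.
   Context: $X$ is connected, with function field $K(X)$. A meromorphic $1$-form on $X$ is of the second kind if all of its residues are $0$ (for $f\in K(X)$ the form $df$ is of the second kind). $H^1_{\mathrm{dR}}(X/K)$ is algebraic de Rham cohomology, the hypercohomology of $\mathcal{O}_X\xrightarrow{d}\Omega^1_{X/K}$. *)

(* Defs.v *)
From HB Require Import structures.
From mathcomp Require Import all_boot all_order all_algebra.
From mathcomp Require Import generic_quotient ring_quotient.
From mathcomp Require mpoly.
From mathcomp Require Import boolp classical_sets functions topology.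

Set Implicit Arguments.
Unset Strict Implicit.
Unset Printing Implicit Defensive.

Import GRing.Theory.

Local Open Scope classical_set_scope.
Local Open Scope quotient_scope.
Local Open Scope ring_scope.

(** * Subquotients of a module *)

Record submodule (R : pzRingType) (V : lmodType R) := Submodule {
  smem :> set V;
  smem0 : smem 0;
  smemD : forall u v, smem u -> smem v -> smem (u + v);
  smemZ : forall a v, smem v -> smem (a *: v) }.

Section Subquot.
Variables (R : pzRingType) (V : lmodType R).

Section Pred.
Variable W : submodule V.

Definition smem_pred : {pred V} := fun v => `[<smem W v>].

Fact smem_pred_closed : GRing.subsemimod_closed smem_pred.
Proof.
split; first split.
- exact/asboolP/smem0.
- by move=> u v /asboolP Pu /asboolP Pv; apply/asboolP/smemD.
- by move=> a v /asboolP Pv; apply/asboolP/smemZ.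
Qed.
HB.instance Definition _ :=
  GRing.isSubmodClosed.Build R V smem_pred smem_pred_closed.

Definition submod := {v : V | v \in smem_pred}.
HB.instance Definition _ := SubChoice.on submod.
HB.instance Definition _ := [SubChoice_isSubLmodule of submod by <:].

Definition quotmod := Quotient.quot smem_pred.
HB.instance Definition _ := GRing.Zmodule.on quotmod.
HB.instance Definition _ := EqQuotient.on quotmod.

Definition quotmod_scale (a : R) (q : quotmod) : quotmod :=
  \pi_quotmod (a *: repr q).

Lemma quotmod_scale_pi a v :
  quotmod_scale a (\pi_quotmod v) = \pi_quotmod (a *: v).
Proof.
apply/eqP; rewrite -Quotient.idealrBE -scalerBr.
by rewrite rpredZ // Quotient.idealrBE reprK.
Qed.

Lemma quotmod_piD u v :
  \pi_quotmod u + \pi_quotmod v = \pi_quotmod (u + v).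
Proof. by rewrite -[RHS]/(\pi_(Quotient.quot smem_pred) (u + v)) Quotient.pi_add. Qed.

Lemma quotmod_scaleA a b v :
  quotmod_scale a (quotmod_scale b v) = quotmod_scale (a * b) v.
Proof. by elim/quotW: v => v; rewrite (quotmod_scale_pi b) !quotmod_scale_pi scalerA. Qed.

Lemma quotmod_scale1 : left_id 1 quotmod_scale.
Proof. by elim/quotW=> v; rewrite quotmod_scale_pi scale1r. Qed.

Lemma quotmod_scaleDr : right_distributive quotmod_scale +%R.
Proof.
move=> a; elim/quotW=> u; elim/quotW=> v.
by rewrite quotmod_piD !quotmod_scale_pi quotmod_piD scalerDr.
Qed.

Lemma quotmod_scaleDl v : {morph quotmod_scale^~ v : a b / a + b}.
Proof.
move=> a b; elim/quotW: v => v.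
by rewrite !quotmod_scale_pi quotmod_piD scalerDl.
Qed.

HB.instance Definition _ := GRing.Zmodule_isLmodule.Build R quotmod
  quotmod_scaleA quotmod_scale1 quotmod_scaleDr quotmod_scaleDl.
End Pred.
End Subquot.

Section Subquot2.
Variables (R : pzRingType) (V : lmodType R) (Z B : submodule V).

Fact trace0 : smem B (val (0 : submod Z)).
Proof. by rewrite raddf0; exact: smem0. Qed.

Fact traceD (u v : submod Z) :
  smem B (val u) -> smem B (val v) -> smem B (val (u + v)).
Proof. by rewrite raddfD; exact: smemD. Qed.

Fact traceZ a (v : submod Z) : smem B (val v) -> smem B (val (a *: v)).
Proof. by rewrite linearZ; exact: smemZ. Qed.

Definition trace_submodule : submodule (submod Z) :=
  @Submodule R (submod Z) [set z | smem B (val z)] trace0 traceD traceZ.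

(* Z / (Z `&` B), that is, Z / B when B is contained in Z, as it is for
   cocycles and coboundaries, and for second_kind and exact_forms. *)
Definition subquot : lmodType R := quotmod trace_submodule.
End Subquot2.

(** * Sheaves of vector spaces *)

Record opens (T : topologicalType) :=
  Opens { oset :> set T; oset_open : open oset }.

Definition opensT (T : topologicalType) : opens T := Opens (@openT T).

Definition opensI (T : topologicalType) (U V : opens T) : opens T :=
  Opens (openI (oset_open U) (oset_open V)).

Lemma opensIl (T : topologicalType) (U V : opens T) : opensI U V `<=` U.
Proof. exact: subIsetl. Qed.

Lemma opensIr (T : topologicalType) (U V : opens T) : opensI U V `<=` V.
Proof. exact: subIsetr. Qed.

Arguments opensIl {T} U V.
Arguments opensIr {T} U V.

Definition open_cover (T : topologicalType) (U : opens T)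
    (C : set (opens T)) :=
  (forall V, C V -> V `<=` U) /\
  (forall x, oset U x -> exists2 V, C V & oset V x).

Record sheaf (K : fieldType) (T : topologicalType) := Sheaf {
  sec :> opens T -> lmodType K;
  res : forall U V : opens T, V `<=` U -> {linear sec U -> sec V};
  res_id : forall (U : opens T) (h : U `<=` U) (s : sec U), res h s = s;
  res_res : forall (U V W : opens T) (h : V `<=` U) (k : W `<=` V)
    (l : W `<=` U) (s : sec U), res k (res h s) = res l s;
  sheaf_sep : forall (U : opens T) (C : set (opens T)), open_cover U C ->
    forall s : sec U,
      (forall (V : opens T) (h : V `<=` U), C V -> res h s = 0) -> s = 0;
  sheaf_glue : forall (U : opens T) (C : set (opens T)), open_cover U C ->
    forall s : (forall V : opens T, sec V),
      (forall (V V' W : opens T) (h : W `<=` V) (h' : W `<=` V'),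
         C V -> C V' -> res h (s V) = res h' (s V')) ->
    exists t : sec U,
      forall (V : opens T) (h : V `<=` U), C V -> res h t = s V }.

Arguments res {K T s U V} h : rename.
Arguments res_id {K T s U} : rename.
Arguments res_res {K T s U V W} : rename.

Section Sheaves.
Variables (K : fieldType) (T : topologicalType).
Implicit Types (F G : sheaf K T) (U V W : opens T).

Record sheaf_hom F G := SheafHom {
  shom :> forall U, {linear F U -> G U};
  shom_res : forall U V (h : V `<=` U) (s : F U),
    shom V (res h s) = res h (shom U s) }.

Definition zero_sheaf : sheaf K T.
Proof.
unshelve refine (@Sheaf K T (fun=> 'rV[K]_0 : lmodType K)
  (fun _ _ _ => idfun) _ _ _ _).
- by [].
- by [].
- by move=> U C _ s _; rewrite [s]thinmx0.
- by move=> U C _ s _; exists 0 => V h _; rewrite [RHS]thinmx0 linear0.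
Defined.

Definition zero_hom F G : sheaf_hom F G.
Proof.
unshelve refine (@SheafHom F G (fun U => \0%R) _).
by move=> U V h s; rewrite /= linear0.
Defined.

Definition injective_sheaf (I : sheaf K T) :=
  forall (A B : sheaf K T) (i : sheaf_hom A B) (f : sheaf_hom A I),
    (forall U, injective (i U)) ->
  exists g : sheaf_hom B I, forall U (s : A U), g U (i U s) = f U s.
End Sheaves.

(** ** Rational sections *)

(* ratsec F is the direct limit of the F U over the dense open sets U; on an
   irreducible space it is the stalk at the generic point, so for the structure
   sheaf it is the function field, and for Omega^1 the space of meromorphic
   1-forms. *)

Section RationalSections.
Variables (K : fieldType) (T : topologicalType).
Implicit Types (U V W : opens T).

Section Defs.
Variable F : sheaf K T.

Record dense_sec := DenseSec {
  dsec_dom : opens T;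
  dsec_dense : dense dsec_dom;
  dsec_sec : F dsec_dom }.

Definition dsec_agree (s t : dense_sec) :=
  exists (W : opens T) (h : W `<=` dsec_dom s) (k : W `<=` dsec_dom t),
    dense W /\ res h (dsec_sec s) = res k (dsec_sec t).

HB.instance Definition _ := gen_eqMixin dense_sec.
HB.instance Definition _ := gen_choiceMixin dense_sec.

Definition dsec_eqv : rel dense_sec := fun s t => `[<dsec_agree s t>].

Lemma opensI_dense U V : dense U -> dense V -> dense (opensI U V).
Proof. by move=> dU dV; apply: denseI => //; exact: oset_open. Qed.

Lemma opensT_dense : dense (opensT T).
Proof. by move=> O O0 _; rewrite setIT. Qed.

Lemma dsec_eqv_equiv : equiv_class_of dsec_eqv.
Proof.
split.
- move=> s; apply/asboolP; exists (dsec_dom s), (@subset_refl _ _).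
  by exists (@subset_refl _ _); split=> //; exact: dsec_dense.
- move=> s t; apply/asboolP/asboolP => -[W [h [k [dW e]]]];
    by exists W, k, h.
- move=> t s u /asboolP[W [h [k [dW e]]]] /asboolP[W' [h' [k' [dW' e']]]].
  apply/asboolP; exists (opensI W W').
  exists (subset_trans (opensIl W W') h).
  exists (subset_trans (opensIr W W') k').
  split; first exact: opensI_dense.
  rewrite -(res_res h (opensIl W W') (subset_trans (opensIl W W') h)).
  rewrite e.
  rewrite -(res_res k' (opensIr W W')
    (subset_trans (opensIr W W') k')) -e'.
  rewrite (res_res _ _ (subset_trans (opensIl W W') k)).
  by rewrite (res_res _ _ (subset_trans (opensIl W W') k)).
Qed.

Canonical dsec_equiv := EquivRelPack dsec_eqv_equiv.
Canonical dsec_encModRel := defaultEncModRel dsec_eqv.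

Definition ratsec := {eq_quot dsec_eqv}.
HB.instance Definition _ := EqQuotient.on ratsec.
HB.instance Definition _ := Choice.on ratsec.

Definition rat U (dU : dense U) (s : F U) : ratsec := \pi_ratsec (DenseSec dU s).

Lemma ratP U V (dU : dense U) (dV : dense V) (s : F U) (t : F V) :
  rat dU s = rat dV t <-> dsec_agree (DenseSec dU s) (DenseSec dV t).
Proof.
split; first by move/eqquotP/asboolP.
by move=> H; apply/eqquotP/asboolP.
Qed.

Lemma rat_eq U V W (dU : dense U) (dV : dense V) (s : F U) (t : F V)
    (h : W `<=` U) (k : W `<=` V) :
  dense W -> res h s = res k t -> rat dU s = rat dV t.
Proof. by move=> dW e; apply/ratP; exists W, h, k. Qed.

Lemma rat_res U V (dU : dense U) (dV : dense V) (h : V `<=` U) (s : F U) :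
  rat dV (res h s) = rat dU s.
Proof.
by apply: (@rat_eq _ _ V _ _ _ _ (@subset_refl _ _) h dV); rewrite res_id.
Qed.

Lemma ratE (u : ratsec) : exists U (dU : dense U) (s : F U), u = rat dU s.
Proof. by elim/quotW: u => -[U dU s]; exists U, dU, s. Qed.

Lemma ratE2 (u v : ratsec) : exists U (dU : dense U) (s t : F U),
  u = rat dU s /\ v = rat dU t.
Proof.
have [U [dU [s ->]]] := ratE u; have [V [dV [t ->]]] := ratE v.
exists (opensI U V), (opensI_dense dU dV), (res (opensIl U V) s).
by exists (res (opensIr U V) t); rewrite !rat_res.
Qed.

Definition rat_add (u v : ratsec) : ratsec :=
  let s := repr u in let t := repr v in
  rat (opensI_dense (dsec_dense s) (dsec_dense t))
    (res (opensIl (dsec_dom s) (dsec_dom t)) (dsec_sec s)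
     + res (opensIr (dsec_dom s) (dsec_dom t)) (dsec_sec t)).

Definition rat_scale (a : K) (u : ratsec) : ratsec :=
  let s := repr u in rat (dsec_dense s) (a *: dsec_sec s).

Definition rat_zero : ratsec := rat opensT_dense 0.

Definition rat_opp (u : ratsec) : ratsec := rat_scale (- 1) u.

Lemma rat_repr U (dU : dense U) (s : F U) :
  dsec_agree (DenseSec dU s) (repr (rat dU s)).
Proof. by apply/asboolP/(eqquotP ratsec); exact/esym/(reprK (rat dU s)). Qed.

Lemma rat_addE U (dU : dense U) (s t : F U) :
  rat_add (rat dU s) (rat dU t) = rat dU (s + t).
Proof.
rewrite /rat_add.
case: (rat_repr dU s) (rat_repr dU t) => W [h [k [dW e]]].
case=> W' [h' [k' [dW' e']]].
set P := repr (rat dU s) in k e *; set Q := repr (rat dU t) in k' e' *.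
rewrite /= in h h' e e'.
have i : opensI W W' `<=` opensI (dsec_dom P) (dsec_dom Q).
  by move=> x [/k ? /k'].
have j : opensI W W' `<=` U by move=> x [/h].
apply: (@rat_eq _ _ _ _ _ _ _ i j (opensI_dense dW dW')); rewrite !linearD.
have il := opensIl W W'; have ir := opensIr W W'.
congr (_ + _).
  have m : opensI W W' `<=` dsec_dom P := subset_trans il k.
  rewrite (res_res _ _ m) -(res_res k il m) -e.
  by rewrite (res_res _ _ j).
have m : opensI W W' `<=` dsec_dom Q := subset_trans ir k'.
rewrite (res_res _ _ m) -(res_res k' ir m) -e'.
by rewrite (res_res _ _ j).
Qed.

Lemma rat_scaleE a U (dU : dense U) (s : F U) :
  rat_scale a (rat dU s) = rat dU (a *: s).
Proof.
rewrite /rat_scale; case: (rat_repr dU s) => W [h [k [dW e]]].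
by apply: (@rat_eq _ _ _ _ _ _ _ k h dW); rewrite !linearZ -e.
Qed.

Lemma rat_zeroE U (dU : dense U) : rat_zero = rat dU 0.
Proof.
have h : U `<=` opensT T by [].
by rewrite /rat_zero -(rat_res opensT_dense dU h) linear0.
Qed.

Lemma rat_addC : commutative rat_add.
Proof.
by move=> u v; have [U [dU [s [t [-> ->]]]]] := ratE2 u v;
   rewrite !rat_addE addrC.
Qed.

Lemma rat_addA : associative rat_add.
Proof.
move=> u v w; have [U [dU [s [t [-> ->]]]]] := ratE2 u v.
have [V [dV [r ->]]] := ratE w.
pose l := opensIl U V; pose d := opensI_dense dU dV.
rewrite -!(rat_res dU d l) -(rat_res dV d (opensIr U V)).
by rewrite !rat_addE addrA.
Qed.

Lemma rat_add0 : left_id rat_zero rat_add.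
Proof.
move=> u; have [U [dU [s ->]]] := ratE u.
by rewrite (rat_zeroE dU) rat_addE add0r.
Qed.

Lemma rat_addN : left_inverse rat_zero rat_opp rat_add.
Proof.
move=> u; have [U [dU [s ->]]] := ratE u.
by rewrite /rat_opp rat_scaleE rat_addE scaleN1r addNr (rat_zeroE dU).
Qed.

HB.instance Definition _ :=
  GRing.isZmodule.Build ratsec rat_addA rat_addC rat_add0 rat_addN.

Lemma ratD U (dU : dense U) (s t : F U) : rat dU s + rat dU t = rat dU (s + t).
Proof. exact: rat_addE. Qed.

Lemma rat_scaleA a b v : rat_scale a (rat_scale b v) = rat_scale (a * b) v.
Proof. by have [U [dU [s ->]]] := ratE v; rewrite !rat_scaleE scalerA. Qed.

Lemma rat_scale1 : left_id 1 rat_scale.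
Proof.
by move=> v; have [U [dU [s ->]]] := ratE v; rewrite rat_scaleE scale1r.
Qed.

Lemma rat_scaleDr : right_distributive rat_scale +%R.
Proof.
move=> a u v; have [U [dU [s [t [-> ->]]]]] := ratE2 u v.
by rewrite !(ratD, rat_scaleE) scalerDr.
Qed.

Lemma rat_scaleDl v : {morph rat_scale^~ v : a b / a + b}.
Proof.
move=> a b; have [U [dU [s ->]]] := ratE v.
by rewrite !(ratD, rat_scaleE) scalerDl.
Qed.

HB.instance Definition _ := GRing.Zmodule_isLmodule.Build K ratsec
  rat_scaleA rat_scale1 rat_scaleDr rat_scaleDl.

Lemma ratZ a U (dU : dense U) (s : F U) : a *: rat dU s = rat dU (a *: s).
Proof. exact: rat_scaleE. Qed.

Lemma rat0 U (dU : dense U) : 0 = rat dU 0.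
Proof. exact: rat_zeroE. Qed.

(* The rational section u is defined on W, with value s there. *)
Definition rat_restricts (u : ratsec) W (s : F W) :=
  exists (V : opens T) (dV : dense V) (t : F V) (h : W `<=` V),
    u = rat dV t /\ res h t = s.
End Defs.

Definition rat_map (F G : sheaf K T) (f : sheaf_hom F G) (u : ratsec F) :
    ratsec G :=
  let s := repr u in rat (dsec_dense s) (f _ (dsec_sec s)).

Lemma rat_mapE (F G : sheaf K T) (f : sheaf_hom F G) U (dU : dense U)
  (s : F U) : rat_map f (rat dU s) = rat dU (f U s).
Proof.
rewrite /rat_map; case: (rat_repr dU s) => W [h [k [dW e]]].
by apply: (@rat_eq _ _ _ _ _ _ _ _ k h dW); rewrite -!shom_res -e.
Qed.
End RationalSections.

(** * Complexes of sheaves and hypercohomology *)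

Section Hypercohomology.
Variables (K : fieldType) (T : topologicalType).

Record complex := Complex {
  cx :> nat -> sheaf K T;
  cx_d : forall n, sheaf_hom (cx n) (cx n.+1);
  cx_dd : forall n (U : opens T) (s : cx n U),
    cx_d n.+1 U (cx_d n U s) = 0 }.

Definition boundary (C : complex) n (U : opens T) : C n U -> Prop :=
  match n with
  | 0 => fun s => s = 0
  | m.+1 => fun s => exists t : C m U, s = cx_d C m U t
  end.

Record cx_hom (C D : complex) := CxHom {
  chom :> forall n, sheaf_hom (C n) (D n);
  chom_d : forall n (U : opens T) (s : C n U),
    chom n.+1 U (cx_d C n U s) = cx_d D n U (chom n U s) }.

Definition locally_boundary (C : complex) n (U : opens T) (s : C n U) :=
  forall x, oset U x ->
  exists (V : opens T) (h : V `<=` U), oset V x /\ boundary (res h s).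

(* The induced maps of cohomology sheaves are injective and surjective. *)
Definition quasi_iso (C D : complex) (f : cx_hom C D) :=
  (forall n (U : opens T) (s : C n U), cx_d C n U s = 0 ->
     locally_boundary (f n U s) -> locally_boundary s) /\
  (forall n (U : opens T) (t : D n U), cx_d D n U t = 0 ->
     forall x, oset U x ->
     exists (V : opens T) (h : V `<=` U) (s : C n V),
       [/\ oset V x, cx_d C n V s = 0 & boundary (res h t - f n V s)]).

Record injective_resolution (C : complex) := InjectiveResolution {
  ir_cx :> complex;
  ir_map : cx_hom C ir_cx;
  ir_inj : forall n, injective_sheaf (ir_cx n);
  ir_qis : quasi_iso ir_map }.

Definition cocycles (C : complex) n : submodule (C n (opensT T)).
Proof.
exists [set s | cx_d C n (opensT T) s = 0].
- by rewrite /= linear0.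
- by move=> u v /= u0 v0; rewrite linearD u0 v0 addr0.
- by move=> a v /= v0; rewrite linearZ /= v0 scaler0.
Defined.

Definition coboundaries (C : complex) n : submodule (C n (opensT T)).
Proof.
exists [set s | boundary s].
- by case: n => //= n; exists 0; rewrite linear0.
- case: n => [|n] /= u v; first by move=> -> ->; rewrite addr0.
  by move=> [s ->] [t ->]; exists (s + t); rewrite linearD.
- case: n => [|n] /= a v; first by move=> ->; rewrite scaler0.
  by move=> [s ->]; exists (a *: s); rewrite linearZ.
Defined.

(* H^n of the complex of global sections of an injective resolution *)
Definition hypercohomology (C : complex) (I : injective_resolution C) n :
  lmodType K := subquot (cocycles I n) (coboundaries I n).
End Hypercohomology.

(** * Varieties over an algebraically closed field *)

(* A space with functions: a topological space with a sheaf of algebras of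
   K-valued functions. *)
Record fspace (K : closedFieldType) := Fspace {
  fs_space :> topologicalType;
  (* regular U f only depends on the restriction of f to U *)
  regular : opens fs_space -> (fs_space -> K) -> Prop;
  regular_ext : forall (U : opens fs_space) f g,
    (forall x, oset U x -> f x = g x) -> regular U f -> regular U g;
  regular_res : forall (U V : opens fs_space) f,
    V `<=` U -> regular U f -> regular V f;
  regular_local : forall (U : opens fs_space) f,
    (forall x, oset U x -> exists V : opens fs_space,
       [/\ oset V x, V `<=` U & regular V f]) -> regular U f;
  regular_cst : forall (U : opens fs_space) c, regular U (fun=> c);
  regularD : forall (U : opens fs_space) f g,
    regular U f -> regular U g -> regular U (fun x => f x + g x);
  regularM : forall (U : opens fs_space) f g,
    regular U f -> regular U g -> regular U (fun x => f x * g x) }.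

Section Varieties.
Variable K : closedFieldType.

Definition zero_set n (S : set (mpoly.mpoly n K)) : set ('I_n -> K) :=
  [set v | forall p, S p -> mpoly.meval v p = 0].

(* phi is an isomorphism of U with the algebraic set zero_set S, carrying its
   Zariski topology and its sheaf of regular functions (locally quotients of
   polynomials). *)
Definition affine (X : fspace K) (U : opens X) :=
  exists n (phi : X -> 'I_n -> K) (S : set (mpoly.mpoly n K)),
  [/\ {in oset U &, injective phi},
      phi @` U = zero_set S,
      forall W : set X, W `<=` U ->
        (open W <->
         exists P, W = U `&` [set x | ~ zero_set P (phi x)])
    & forall (W : opens X) f, W `<=` U ->
        (regular W f <->
         forall x, oset W x -> exists p q, \forall y \near x,
           mpoly.meval (phi y) q != 0 /\
           f y = mpoly.meval (phi y) p / mpoly.meval (phi y) q)].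

Record prevariety := Prevariety {
  pv_fspace :> fspace K;
  pv_affine : exists n (C : 'I_n -> opens pv_fspace),
    (forall i, affine (C i)) /\ (forall x, exists i, oset (C i) x) }.

(* Closed sets of the product variety: on a product of affine open sets, the
   regular functions are the sums of the f (x) * g (y). *)
Definition product_closed (X Y : prevariety) (Z : set (X * Y)) :=
  forall (U : opens X) (V : opens Y), affine U -> affine V ->
  exists S : set (X * Y -> K),
    (forall h, S h -> exists n (f : 'I_n -> X -> K) (g : 'I_n -> Y -> K),
       [/\ forall i, regular U (f i), forall i, regular V (g i)
         & forall x y, oset U x -> oset V y ->
             h (x, y) = \sum_i f i x * g i y]) /\
    (forall x y, oset U x -> oset V y ->
       (Z (x, y) <-> forall h, S h -> h (x, y) = 0)).

Definition separated (X : prevariety) :=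
  product_closed [set z : X * X | z.1 = z.2].

Definition complete (X : prevariety) :=
  separated X /\
  forall (Y : prevariety) (Z : set (X * Y)),
    product_closed Z -> closed (snd @` Z).

Definition irreducible (T : topologicalType) (A : set T) :=
  A !=set0 /\ forall C D : set T, closed C -> closed D ->
    A `<=` C `|` D -> A `<=` C \/ A `<=` D.

Definition irreducible_chain (T : topologicalType) n :=
  exists Z : nat -> set T,
    (forall i, (i <= n)%N -> closed (Z i) /\ irreducible (Z i)) /\
    (forall i, (i < n)%N -> Z i `<` Z i.+1).

Definition krull_dim (T : topologicalType) n :=
  irreducible_chain T n /\ ~ irreducible_chain T n.+1.

Section LocalRings.
Variable X : prevariety.

Definition regular_at (x : X) (f : X -> K) :=
  exists U : opens X, oset U x /\ regular U f.

(* germs at x are represented by functions on X regular near x *)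
Definition max_ideal (x : X) (f : X -> K) := regular_at x f /\ f x = 0.

Definition max_ideal2 (x : X) (f : X -> K) :=
  exists n (a b : 'I_n -> X -> K),
    [/\ forall i, max_ideal x (a i), forall i, max_ideal x (b i)
      & \forall y \near x, f y = \sum_i a i y * b i y].

(* the class of t is a basis of m_x / m_x^2 *)
Definition local_parameter (x : X) (t : X -> K) :=
  max_ideal x t /\
  forall f, max_ideal x f ->
    exists! c : K, max_ideal2 x (fun y => f y - c * t y).
End LocalRings.

(* dim m_x / m_x^2 = 1 = dim X at every point *)
Definition smooth_curve (X : prevariety) :=
  [/\ separated X, krull_dim X 1%N
    & forall x : X, exists t, local_parameter x t].

Definition smooth_complete_curve (X : prevariety) :=
  smooth_curve X /\ complete X.

(** * The structure sheaf *)

Section StructureSheaf.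
Variable X : prevariety.
Implicit Types U V : opens X.

(* A section over U is represented by its extension by 0 to X. *)
Definition regular_submodule U : submodule (X -> K^o).
Proof.
exists [set f | regular U f /\ forall x, ~ oset U x -> f x = 0].
- by split=> //; exact: regular_cst.
- move=> f g [rf f0] [rg g0]; split; first exact: regularD.
  by move=> x nx; have := addr0 (0 : K); rewrite -{1}(f0 x nx) -{1}(g0 x nx).
- move=> a f [rf f0]; split.
    exact: (regularM (regular_cst U a) rf).
  by move=> x nx; have := mulr0 a; rewrite -{1}(f0 x nx).
Defined.

Definition regfun U := submod (regular_submodule U).
HB.instance Definition _ U := GRing.Lmodule.on (regfun U).

Definition rfun U (f : regfun U) : X -> K := val f.

Lemma regfunP U (f : regfun U) :
  regular U (rfun f) /\ forall x, ~ oset U x -> rfun f x = 0.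
Proof. by have /asboolP := valP f. Qed.

Lemma regfun_eq U (f g : regfun U) :
  (forall x, oset U x -> rfun f x = rfun g x) -> f = g.
Proof.
move=> fg; apply/val_inj/funext => x.
have [Ux|nUx] := pselect (oset U x); first exact: fg.
have [_ f0] := regfunP f; have [_ g0] := regfunP g.
by rewrite -[LHS]/(rfun f x) f0 // -[RHS]/(rfun g x) g0.
Qed.

Section Mk.
Variables (U : opens X) (f : X -> K) (rf : regular U f).

Fact regfun_mk_subproof :
  (fun x => if `[<oset U x>] then f x else 0) \in
    smem_pred (regular_submodule U).
Proof.
apply/asboolP; split; last by move=> x nx; case: asboolP.
by apply: regular_ext rf => x Ux; case: asboolP.
Qed.

Definition regfun_mk : regfun U :=
  exist (fun v : X -> K^o => v \in smem_pred (regular_submodule U)) _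
    regfun_mk_subproof.

Lemma regfun_mkE x : oset U x -> rfun regfun_mk x = f x.
Proof. by rewrite /rfun /= => Ux; case: asboolP. Qed.
End Mk.

Lemma rfunD U (f g : regfun U) x : rfun (f + g) x = rfun f x + rfun g x.
Proof. by rewrite /rfun raddfD. Qed.

Lemma rfunZ U a (f : regfun U) x : rfun (a *: f) x = a * rfun f x.
Proof. by rewrite /rfun linearZ. Qed.

Lemma rfun0 U x : rfun (0 : regfun U) x = 0.
Proof. by rewrite /rfun raddf0. Qed.

Definition regfun_one U : regfun U := regfun_mk (regular_cst U 1).

Definition regfun_mul U (f g : regfun U) : regfun U :=
  regfun_mk (regularM (regfunP f).1 (regfunP g).1).

Lemma regfun_mulE U (f g : regfun U) x :
  rfun (regfun_mul f g) x = rfun f x * rfun g x.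
Proof.
have [Ux|nUx] := pselect (oset U x); first by rewrite regfun_mkE.
by rewrite (regfunP _).2 // (regfunP f).2 // mul0r.
Qed.

Lemma regfun_mulA U : associative (@regfun_mul U).
Proof. by move=> f g h; apply: regfun_eq => x _; rewrite !regfun_mulE mulrA. Qed.

Lemma regfun_mulC U : commutative (@regfun_mul U).
Proof. by move=> f g; apply: regfun_eq => x _; rewrite !regfun_mulE mulrC. Qed.

Lemma regfun_mul1 U : left_id (regfun_one U) (@regfun_mul U).
Proof.
by move=> f; apply: regfun_eq => x Ux; rewrite regfun_mulE regfun_mkE // mul1r.
Qed.

Lemma regfun_mulDl U : left_distributive (@regfun_mul U) +%R.
Proof.
move=> f g h; apply: regfun_eq => x _.
by rewrite regfun_mulE !rfunD !regfun_mulE mulrDl.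
Qed.

HB.instance Definition _ U := GRing.Zmodule_isComPzRing.Build (regfun U)
  (@regfun_mulA U) (@regfun_mulC U) (@regfun_mul1 U) (@regfun_mulDl U).

Definition regfun_res U V (h : V `<=` U) (f : regfun U) : regfun V :=
  regfun_mk (regular_res h (regfunP f).1).

Lemma regfun_resE U V (h : V `<=` U) (f : regfun U) x :
  oset V x -> rfun (regfun_res h f) x = rfun f x.
Proof. exact: regfun_mkE. Qed.

Fact regfun_res_linear U V (h : V `<=` U) : linear (regfun_res h).
Proof.
move=> a f g; apply: regfun_eq => x Vx.
by rewrite !(rfunD, rfunZ, regfun_resE h _ Vx).
Qed.

HB.instance Definition _ U V (h : V `<=` U) :=
  GRing.isLinear.Build K (regfun U) (regfun V) _ (regfun_res h)
    (regfun_res_linear h).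

Definition regular_sheaf : sheaf K X.
Proof.
unshelve refine (@Sheaf K X (fun U => regfun U : lmodType K)
  (fun U V h => regfun_res h) _ _ _ _).
- by move=> U h f; apply: regfun_eq => x Ux; rewrite regfun_resE.
- move=> U V W h k l f; apply: regfun_eq => x Wx.
  by rewrite !regfun_resE //; exact: k.
- move=> U C [CU UC] f f0; apply: regfun_eq => x Ux.
  have [V CV Vx] := UC x Ux.
  by rewrite -(regfun_resE (CU V CV) f Vx) /= f0 // !rfun0.
- move=> U C [CU UC] s sC.
  pose g x := if pselect (exists2 V, C V & oset V x) is left p
              then rfun (s (projT1 (cid2 p))) x else 0.
  have gE V x : C V -> oset V x -> g x = rfun (s V) x.
    rewrite /g => CV Vx; case: pselect => [p|[]]; last by exists V.
    case: cid2 => V' CV' V'x /=.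
    have /(congr1 (fun f => rfun f x)) :=
      sC V' V (opensI V' V) (opensIl V' V) (opensIr V' V) CV' CV.
    by rewrite /= !regfun_resE.
  have rg : regular U g.
    apply: regular_local => x Ux; have [V CV Vx] := UC x Ux.
    exists V; split=> //; first exact: CU.
    by apply: regular_ext (regfunP (s V)).1 => y Vy; rewrite (gE V).
  exists (regfun_mk rg) => V h CV; apply: regfun_eq => x Vx.
  by rewrite /= regfun_resE // regfun_mkE ?(gE V) //; exact: h.
Defined.

(** * Kähler differentials *)

Definition derivation (U : opens X) (M : lmodType (regfun U))
    (D : regfun U -> M) :=
  [/\ forall f g, D (f + g) = D f + D g,
      forall f g, D (f * g) = f *: D g + g *: D f
    & forall c : K, D (c *: (1 : regfun U)) = 0].

(* (Omega^1_{X/K}, d): a sheaf of O_X-modules which on affine open sets is the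
   module of differentials of O(U) over K. *)
Record kahler := Kahler {
  ksheaf :> sheaf K X;
  kact : forall U, regfun U -> ksheaf U -> ksheaf U;
  kactDl : forall U (f g : regfun U) (w : ksheaf U),
    kact (f + g) w = kact f w + kact g w;
  kactDr : forall U (f : regfun U) (v w : ksheaf U),
    kact f (v + w) = kact f v + kact f w;
  kactM : forall U (f g : regfun U) (w : ksheaf U),
    kact (f * g) w = kact f (kact g w);
  kact_cst : forall U (c : K) (w : ksheaf U), kact (c *: (1 : regfun U)) w = c *: w;
  kact_res : forall U V (h : V `<=` U) (f : regfun U) (w : ksheaf U),
    res h (kact f w) = kact (regfun_res h f) (res h w);
  kd : sheaf_hom regular_sheaf ksheaf;
  kdM : forall U (f g : regfun U),
    kd U (f * g) = kact f (kd U g) + kact g (kd U f);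
  kahler_univ : forall U, affine U ->
    forall (M : lmodType (regfun U)) (D : regfun U -> M), derivation D ->
    exists! phi : ksheaf U -> M,
      [/\ forall v w, phi (v + w) = phi v + phi w,
          forall f w, phi (kact f w) = f *: phi w
        & forall f, phi (kd U f) = D f] }.

Section DeRham.
Variable Om : kahler.

Definition de_rham_sheaf n : sheaf K X :=
  match n with
  | 0 => regular_sheaf
  | 1 => Om
  | _ => zero_sheaf K X
  end.

Definition de_rham_d n : sheaf_hom (de_rham_sheaf n) (de_rham_sheaf n.+1) :=
  match n with
  | 0 => kd Om
  | _ => zero_hom _ _
  end.

Definition de_rham : complex K X.
Proof.
by unshelve refine (@Complex K X de_rham_sheaf de_rham_d _); case.
Defined.

(** * Forms of the second kind *)

Definition function_field := ratsec regular_sheaf.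

Definition exact_forms : submodule (ratsec Om).
Proof.
exists [set w | exists f : function_field, w = rat_map (kd Om) f].
- exists (rat (@opensT_dense X) (0 : regular_sheaf (opensT X))); rewrite rat_mapE linear0; exact: rat0.
- move=> _ _ [f ->] [g ->]; have [U [dU [s [t [-> ->]]]]] := ratE2 f g.
  by exists (rat dU (s + t)); rewrite !rat_mapE ratD linearD.
- move=> a _ [f ->]; have [U [dU [s ->]]] := ratE f.
  by exists (rat dU (a *: s)); rewrite !rat_mapE ratZ linearZ.
Defined.

(* On a punctured neighbourhood W of x, w = (p (1/t) + g) dt with g regular at
   x: p (1/t) is the polar part of the Laurent expansion of w / dt (up to a
   constant), and the residue is the coefficient of 1/t. A local parameter t
   vanishes only at x near x, so that t != 0 on W after shrinking W. *)
Definition has_residue (x : X) (t : X -> K) (w : ratsec Om) (a : K) :=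
  exists (W : opens X) (s : Om W) (tW h : regfun W) (p : {poly K})
         (g : X -> K),
    [/\ x^' (oset W), rat_restricts w s,
        forall y, oset W y ->
          rfun tW y = t y /\ rfun h y = p.[(t y)^-1] + g y,
        regular_at x g & s = kact h (kd Om W tW) /\ a = p`_1].

Lemma kact0 U (w : Om U) : kact 0 w = 0.
Proof. by rewrite -[X in kact X _](scale0r (1 : regfun U)) kact_cst scale0r. Qed.

Lemma kactZ U a (f : regfun U) (w : Om U) : kact (a *: f) w = a *: kact f w.
Proof.
rewrite -(kact_cst a (kact f w)) -kactM; congr kact.
apply: regfun_eq => x Ux.
by rewrite regfun_mulE !rfunZ regfun_mkE // mulr1.
Qed.

Lemma regular_at_cst (x : X) c : regular_at x (fun=> c).
Proof. by exists (opensT X); split=> //; exact: regular_cst. Qed.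

Lemma regular_atD (x : X) f g :
  regular_at x f -> regular_at x g -> regular_at x (fun y => f y + g y).
Proof.
move=> [U [Ux rf]] [V [Vx rg]]; exists (opensI U V); split=> //.
by apply: regularD; [apply: regular_res rf|apply: regular_res rg];
  [exact: opensIl|exact: opensIr].
Qed.

Lemma regular_atZ (x : X) a f :
  regular_at x f -> regular_at x (fun y => a * f y).
Proof.
by move=> [U [Ux rf]]; exists U; split=> //; apply: regularM => //;
  exact: regular_cst.
Qed.

Lemma has_residue0 (x : X) t : regular_at x t -> has_residue x t 0 0.
Proof.
move=> [U [Ux rt]].
exists U, 0, (regfun_mk rt), 0, 0, (fun=> 0); split.
- by apply: nbhs_dnbhs; apply: open_nbhs_nbhs; split; first exact: oset_open.
- have h : U `<=` opensT X by [].
  exists (opensT X), (@opensT_dense X), 0, h; rewrite linear0.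
  by split=> //; exact: rat0.
- by move=> y Uy; rewrite regfun_mkE // rfun0 horner0 addr0.
- exact: regular_at_cst.
- by rewrite kact0 coef0.
Qed.

Lemma has_residueD (x : X) t (v w : ratsec Om) a b :
  has_residue x t v a -> has_residue x t w b -> has_residue x t (v + w) (a + b).
Proof.
move=> [W [s [tW [h [p [g [nW vs E rg [es ea]]]]]]]].
move=> [W' [s' [tW' [h' [p' [g' [nW' ws E' rg' [es' ea']]]]]]]].
pose l := opensIl W W'; pose r := opensIr W W'.
exists (opensI W W'), (res l s + res r s'), (regfun_res l tW).
exists (regfun_res l h + regfun_res r h'), (p + p'), (fun y => g y + g' y).
have et : regfun_res l tW = regfun_res r tW'.
  apply: regfun_eq => y [Wy W'y]; rewrite !regfun_resE //.
  by rewrite (E y Wy).1 (E' y W'y).1.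
split.
- exact: filterI.
- move: vs ws => [V [dV [u [k [-> eu]]]]] [V' [dV' [u' [k' [-> eu']]]]].
  have m : opensI W W' `<=` opensI V V' by move=> y [/k ? /k'].
  exists (opensI V V'), (opensI_dense dV dV').
  exists (res (opensIl V V') u + res (opensIr V V') u'), m.
  rewrite -ratD !rat_res; split=> //; rewrite linearD -eu -eu'.
  have n : opensI W W' `<=` V by move=> y [/k].
  have n' : opensI W W' `<=` V' by move=> y [_ /k'].
  by rewrite (res_res _ _ n) (res_res _ _ n') (res_res _ _ n) (res_res _ _ n').
- move=> y [Wy W'y]; rewrite regfun_resE // (E y Wy).1 rfunD !regfun_resE //.
  by rewrite (E y Wy).2 (E' y W'y).2 hornerD addrACA.
- exact: regular_atD.
- rewrite coefD -ea -ea'; split=> //.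
  rewrite es es' !kact_res kactDl -!shom_res /=.
  by rewrite et.
Qed.

Lemma has_residueZ (x : X) t c (w : ratsec Om) a :
  has_residue x t w a -> has_residue x t (c *: w) (c * a).
Proof.
move=> [W [s [tW [h [p [g [nW [V [dV [u [k [-> eu]]]]] E rg [es ea]]]]]]]].
exists W, (c *: s), tW, (c *: h), (c *: p), (fun y => c * g y); split=> //.
- by exists V, dV, (c *: u), k; rewrite ratZ linearZ /= eu.
- by move=> y Wy; rewrite rfunZ (E y Wy).1 (E y Wy).2 hornerZ mulrDr.
- exact: regular_atZ.
- by rewrite coefZ -ea es kactZ.
Qed.

(* The residue does not depend on the local parameter used to compute it; we
   require it to be 0 for each of them. *)
Definition second_kind : submodule (ratsec Om).
Proof.
exists [set w | forall x t, local_parameter x t -> has_residue x t w 0].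
- by move=> x t [[rt _] _]; exact: has_residue0.
- move=> v w rv rw x t lt; rewrite -[0](addr0 0).
  by apply: has_residueD; [exact: rv|exact: rw].
- by move=> a w rw x t lt; rewrite -(mulr0 a); apply: has_residueZ; exact: rw.
Defined.
End DeRham.
End StructureSheaf.
End Varieties.

(* Main.v *)
(* The forms of the second kind are the sections of a sheaf S: those w which,
   locally, are the sum of a regular form u and of the differential df of a
   rational function; in characteristic 0 this is what the vanishing of all
   residues means. The complex K(X) -> S is quasi-isomorphic to the de Rham
   complex and K(X) is flasque, so H^1_dR is the quotient of the global sections
   of S by dK(X).

   Concretely, let iota be the augmentation to the injective resolution I. The
   inclusion of the structure sheaf in the sheaf of all functions with values in
   K(X) and the injectivity of I^0 extend iota^0 to a map E from K(X) to I^0, and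
   w = u + df is sent to the section of I^1 given locally by iota u + d (E f).
   This does not depend on u and f because a rational function with a regular
   differential is regular. For the surjectivity, a cocycle i is
   locally iota u + dk, and the differences of the k come from regular functions
   which form a cocycle; it splits in the constant sheaf K(X).

   The local facts on a smooth curve rest on the principality of the maximal
   ideal (t) (Nakayama), on the factorization f = u t^k with u invertible (Krull,
   through Hilbert's basis theorem), and on Omega^1 being free with basis dt. *)

From HB Require Import structures.
From mathcomp Require Import all_boot all_order all_algebra.
From mathcomp Require Import generic_quotient ring_quotient.
From mathcomp Require mpoly.
From mathcomp Require Import ring.
From mathcomp Require Import boolp classical_sets functions topology.
Import -(notations) mpoly.
Require Import Defs.

Set Implicit Arguments.
Unset Strict Implicit.
Unset Printing Implicit Defensive.

Import GRing.Theory.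
Local Open Scope classical_set_scope.
Local Open Scope quotient_scope.
Local Open Scope ring_scope.

(** * Hilbert's basis theorem *)

Section Noetherian.

(** Germs are represented by functions regular near a point, and no local ring is assumed to be a
    domain. Connectedness is turned into irreducibility through smoothness: once local rings are
    known to be domains, the closure of an open set is open. This makes a regular function or form
    determined by its restriction to any nonempty open set, and gives sense to K(X).

    Arbitrary K(X)-valued functions replace the constant sheaf because they glue without
    sheafification; E is evaluated on constant functions. The image of w is given by a relation, so
    that nothing has to be chosen linearly.

    [kahler] describes Omega^1 by a universal property on affine open sets. That dt spans comes from
    generation by differentials and from Nakayama; that dt is nonzero comes from testing the
    property on a residue field. Rabinowitsch's trick supplies the small affine neighbourhoods that
    both need.

    Characteristic 0 intervenes twice, each time to divide by a positive integer: in the integration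
    of a polar part, and in the comparison of the poles of f and df. *)

Definition in_ideal (R : comNzRingType) (s : seq R) (p : R) :=
  exists c : nat -> R, p = \sum_(i < size s) c i * s`_i.

Definition is_ideal (R : comNzRingType) (I : set R) :=
  [/\ I 0, forall p q, I p -> I q -> I (p + q) & forall a p, I p -> I (a * p)].

Definition noetherian (R : comNzRingType) :=
  forall I : set R, is_ideal I ->
  exists s : seq R, (forall x, x \in s -> I x) /\
    forall p, I p -> in_ideal s p.

Lemma in_ideal0 (R : comNzRingType) (s : seq R) : in_ideal s 0.
Proof. by exists (fun=> 0); rewrite big1 // => i _; rewrite mul0r. Qed.

Lemma in_idealD (R : comNzRingType) (s : seq R) p q :
  in_ideal s p -> in_ideal s q -> in_ideal s (p + q).
Proof.
move=> [c ->] [d ->]; exists (fun i => c i + d i).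
by rewrite -big_split; apply: eq_bigr => i _; rewrite mulrDl.
Qed.

Lemma in_idealM (R : comNzRingType) (s : seq R) a p :
  in_ideal s p -> in_ideal s (a * p).
Proof.
move=> [c ->]; exists (fun i => a * c i).
by rewrite mulr_sumr; apply: eq_bigr => i _; rewrite mulrA.
Qed.

Lemma in_ideal_sum (R : comNzRingType) (s : seq R) n (F : 'I_n -> R) :
  (forall i, in_ideal s (F i)) -> in_ideal s (\sum_(i < n) F i).
Proof.
move=> sF; elim/big_ind: _ => //; first exact: in_ideal0.
exact: in_idealD.
Qed.

Lemma in_ideal_mem (R : comNzRingType) (s : seq R) p : p \in s -> in_ideal s p.
Proof.
move=> ps; exists (fun i => (i == index p s)%:R).
have lt : (index p s < size s)%N by rewrite index_mem.
rewrite (bigD1 (Ordinal lt)) //= eqxx mul1r nth_index // big1 ?addr0 //.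
by move=> i; rewrite -val_eqE /= => /negbTE ->; rewrite mul0r.
Qed.

Lemma is_ideal_sum (R : comNzRingType) (I : set R) n (c F : 'I_n -> R) :
  is_ideal I -> (forall i, I (F i)) -> I (\sum_(i < n) c i * F i).
Proof.
move=> [I0 ID IM] IF; elim/big_ind: _ => //.
by move=> i _; exact: IM.
Qed.

Lemma noetherian_field (K : fieldType) : noetherian K.
Proof.
move=> I [I0 ID IM]; have [[a [a0 Ia]]|nI] := pselect (exists a, a != 0 /\ I a).
  exists [:: a]; split=> [x|p _]; first by rewrite inE => /eqP ->.
  by exists (fun=> p / a); rewrite big_ord1 /= divfK.
exists [::]; split=> // p Ip; have -> : p = 0 by apply: contrapT => /eqP p0; apply: nI; exists p.
exact: in_ideal0.
Qed.

Lemma noetherian_surj (R S : comNzRingType) (h : {rmorphism R -> S}) :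
  (forall q, exists p, h p = q) -> noetherian R -> noetherian S.
Proof.
move=> hsur nR I [I0 ID IM].
have [|s [sI Is]] := nR [set p | I (h p)].
  split=> /=; first by rewrite rmorph0.
  - by move=> p q; rewrite rmorphD; exact: ID.
  - by move=> a p; rewrite rmorphM; exact: IM.
exists (map h s); split=> [x /mapP[p ps ->]|q]; first exact: sI.
have [p <-] := hsur q => /Is [c ->]; exists (fun i => h (c i)).
rewrite rmorph_sum size_map; apply: eq_bigr => i _.
by rewrite rmorphM (nth_map 0).
Qed.

(** * Ideals of leading coefficients *)

Section HilbertBasis.
Variables (R : comNzRingType) (I : set {poly R}).
Hypotheses (nR : noetherian R) (iI : is_ideal I).

(** The size is bounded instead of prescribed, so that 0 belongs to [L n] and [L n] is an ideal. *)
Let L n : set R := [set a | exists p, [/\ I p, (size p <= n.+1)%N & p`_n = a]].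

Let L_ideal n : is_ideal (L n).
Proof.
have [I0 ID IM] := iI; split.
- by exists 0; rewrite size_poly0 coef0.
- move=> _ _ [p [Ip sp <-]] [q [Iq sq <-]]; exists (p + q).
  split; [exact: ID| |by rewrite coefD].
  by rewrite (leq_trans (size_polyD _ _)) // geq_max sp.
- move=> a _ [p [Ip sp <-]]; exists (a%:P * p).
  split; [exact: IM| |by rewrite coefCM].
  by rewrite mul_polyC (leq_trans (size_scale_leq _ _)).
Qed.

Let LS n m a : (n <= m)%N -> L n a -> L m a.
Proof.
have [I0 ID IM] := iI.
move=> /subnK <-; elim: (m - n)%N => // k IH /IH [p [Ip sp <-]].
exists ('X * p); split; first exact: IM.
- have [->|p0] := eqVneq p 0; first by rewrite mulr0 size_poly0.
  by rewrite mulrC size_mulX.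
- by rewrite coefXM.
Qed.

(** Lifts to [I] of generators of [L n], shifted by ['X^(m - n)], combine to cancel the leading term
    of [p]. *)
Let gens n : exists s : seq {poly R}, (forall x, x \in s -> I x) /\
  forall m p, I p -> (n <= m)%N -> (size p <= m.+1)%N -> L n (p`_m) ->
    exists q, [/\ I q, in_ideal s q & (size (p - q)%R <= m)%N].
Proof.
have [I0 ID IM] := iI.
have [s [sL Ls]] := nR (L_ideal n).
have ex a : exists p, a \in s -> [/\ I p, (size p <= n.+1)%N & p`_n = a].
  by have [/sL[p ?]|//] := boolP (a \in s); [exists p|exists 0].
have [f fP] := choice ex.
exists (map f s); split=> [_ /mapP[a as_ ->]|m p Ip nm sp /Ls [c pc]].
  by case: (fP a as_).
pose q := \sum_(i < size s) ('X^(m - n) * (c i)%:P) * f (s`_i).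
have Iq : I q.
  by apply: is_ideal_sum => // i; case: (fP (s`_i)) => //; exact: mem_nth.
exists q; split=> //.
  apply: in_ideal_sum => i; apply/in_idealM/in_ideal_mem/map_f.
  exact: mem_nth.
have sq : (size q <= m.+1)%N.
  apply: (leq_trans (size_sum _ _ _)); apply/bigmax_leqP => i _.
  have [_ sf _] := fP (s`_i) (mem_nth _ (ltn_ord i)).
  rewrite -mulrA mulrC mul_polyC -!mul_polyC -mulrA.
  rewrite mul_polyC (leq_trans (size_scale_leq _ _)) //.
  have [->|f0] := eqVneq (f (s`_i)) 0; first by rewrite mul0r size_poly0.
  by rewrite size_mulXn // -{2}(subnK nm) -addnS leq_add2l.
have eq : q`_m = p`_m.
  rewrite pc coef_sum; apply: eq_bigr => i _.
  have [_ sf fE] := fP (s`_i) (mem_nth _ (ltn_ord i)).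
  rewrite -mulrA coefXnM ltnNge leq_subr /= subKn // coefCM fE //.
apply/leq_sizeP => j; rewrite leq_eqVlt => /predU1P[<-|mj].
  by rewrite coefB eq subrr.
rewrite coefB !nth_default ?subr0 //; exact: leq_trans mj.
Qed.

(** The ideals [L n] increase, so their union is an ideal, and its finitely many generators all lie
    in one [L N]. Induction on the size of [p] then removes leading terms. *)
Lemma hilbert_ideal : exists s : seq {poly R}, (forall x, x \in s -> I x) /\
    forall p, I p -> in_ideal s p.
Proof.
have [I0 ID IM] := iI.
have [|s [sL Ls]] := nR (I := [set a | exists n, L n a]).
  split; first by exists 0%N; case: (L_ideal 0).
    move=> a b [n La] [m Lb]; exists (maxn n m).
    case: (L_ideal (maxn n m)) => _ LD _; apply: LD.
      exact: LS (leq_maxl _ _) La.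
    exact: LS (leq_maxr _ _) Lb.
  by move=> a b [n Lb]; exists n; case: (L_ideal n) => _ _; exact.
have [N LN] : exists N, forall x, x \in s -> L N x.
  elim: s sL {Ls} => [|x s IH] sL; first by exists 0%N.
  have [|N NP] := IH; first by move=> y ys; apply: sL; rewrite inE ys orbT.
  have [n nx] : exists n, L n x by apply: sL; rewrite mem_head.
  exists (maxn n N) => y; rewrite inE => /predU1P[->|/NP].
    exact: LS (leq_maxl _ _) nx.
  exact: LS (leq_maxr _ _).
have LE n a : L n a -> L N a.
  move=> La; have [|c ->] := Ls a; first by exists n.
  by apply: is_ideal_sum => // i; apply/LN/mem_nth.
have [g gP] := choice gens.
exists (flatten (map g (iota 0 N.+1))); split=> [x /flattenP[_ /mapP[n _ ->]]|p Ip].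
  by case: (gP n) => + _; exact.
have [m] := ubnP (size p); elim: m p Ip => // m IH p Ip sp.
have [p0|p0] := posnP (size p).
  by move/eqP: p0; rewrite size_poly_eq0 => /eqP ->; exact: in_ideal0.
pose k := (size p).-1; have sk : (size p <= k.+1)%N by rewrite /k prednK.
have Lk : L k (p`_k) by exists p; split.
(* Every [L n] is contained in [L N], so the lifts chosen for [N] serve all higher degrees. *)
pose n := minn k N.
have Ln : L n (p`_k).
  by rewrite /n /minn; case: ltnP => // _; exact: LE Lk.
have [_ /(_ k p Ip (geq_minl _ _) sk Ln) [q [Iq gq spq]]] := gP n.
rewrite -(subrK q p); apply: in_idealD.
  apply: IH; first by rewrite -scaleN1r -mul_polyC; apply: ID => //; exact: IM.
  by apply: leq_ltn_trans spq _; rewrite /k prednK.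
case: gq => c ->; apply: in_ideal_sum => i; apply/in_idealM/in_ideal_mem.
apply/flattenP; exists (g n); last exact: mem_nth.
by apply: map_f; rewrite mem_iota /= add0n ltnS geq_minr.
Qed.
End HilbertBasis.

(** * Polynomials in several variables *)

Lemma noetherian_poly (R : comNzRingType) :
  noetherian R -> noetherian {poly R}.
Proof. by move=> nR I iI; exact: hilbert_ideal. Qed.

(** Reduces statements on polynomials to generators of the algebra; Taylor expansions, denominators
    and differentials are all handled this way. *)
Lemma mpoly_alg_ind (K : comNzRingType) n (P : mpoly n K -> Prop) :
  (forall c, P (mpolyC n c)) -> (forall i, P (mpolyX K (mnm1 i))) ->
  (forall p q, P p -> P q -> P (p + q)) ->
  (forall p q, P p -> P q -> P (p * q)) ->
  forall p, P p.
Proof.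
move=> PC PX PD PM; apply: mpolyind; first by rewrite -mpolyC0.
move=> c m p _ _ Pp; apply: PD => //; rewrite -mul_mpolyC; apply: (PM) => //.
rewrite (mpolyXE_id K m); elim/big_ind: _ => [||i _].
- by rewrite -mpolyC1.
- exact: PM.
elim: (m i) => [|k IH]; first by rewrite expr0 -mpolyC1.
by rewrite exprS; exact: PM.
Qed.

Lemma noetherian_mpoly (K : fieldType) n : noetherian (mpoly n K).
Proof.
elim: n => [|n IH].
  apply: (@noetherian_surj K _ (@mpolyC 0 K)); last exact: noetherian_field.
  apply: mpoly_alg_ind.
  - by move=> c; exists c.
  - by move=> [].
  - by move=> _ _ [a <-] [b <-]; exists (a + b); rewrite rmorphD.
  - by move=> _ _ [a <-] [b <-]; exists (a * b); rewrite rmorphM.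
pose X : mpoly n.+1 K := mpolyX K (mnm1 ord_max).
have cX : commr_rmorph (@mwiden n K) X by move=> p; exact: mulrC.
(* Substituting the last variable maps [{poly mpoly n K}] onto [mpoly n.+1 K]. *)
apply: (@noetherian_surj _ _ (horner_morph cX)); last exact: noetherian_poly.
apply: mpoly_alg_ind.
- by move=> c; exists (polyC (mpolyC n c)); apply: (etrans (horner_morphC cX _)); exact: mwidenC.
- move=> i; case: (unliftP ord_max i) => [j ->|->].
    exists (polyC (mpolyX K (mnm1 j))); apply: (etrans (horner_morphC cX _)).
    apply: (etrans (mwidenX _ _)); rewrite mnmwiden1.
    congr (mpolyX _ (mnm1 _)); apply: val_inj => /=.
    by rewrite /bump leqNgt ltn_ord.
  by exists 'X; exact: (horner_morphX cX).
- by move=> _ _ [a <-] [b <-]; exists (a + b); rewrite rmorphD.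
- by move=> _ _ [a <-] [b <-]; exists (a * b); rewrite rmorphM.
Qed.

(** The ascending chain condition in the form that Krull's argument needs: finitely many generators
    of the ideal spanned by the sequence lie in the span of an initial segment. *)
Lemma noetherian_seq (R : comNzRingType) (p : nat -> R) : noetherian R ->
  exists N (c : nat -> R), p N = \sum_(i < N) c i * p i.
Proof.
move=> nR; have mono N M q : (N <= M)%N -> in_ideal (mkseq p N) q -> in_ideal (mkseq p M) q.
  move=> NM [c ->]; apply: in_ideal_sum => i; apply/in_idealM/in_ideal_mem.
  have iN : (i < N)%N by rewrite -{2}(size_mkseq p N).
  by rewrite nth_mkseq //; apply: map_f; rewrite mem_iota /= (leq_trans iN).
have [|s [sJ Js]] := nR [set q | exists N, in_ideal (mkseq p N) q].
  split; first by exists 0%N; exact: in_ideal0.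
  - move=> a b [N aN] [M bM]; exists (maxn N M); apply: in_idealD.
      exact: mono (leq_maxl _ _) aN.
    exact: mono (leq_maxr _ _) bM.
  - by move=> a b [N bN]; exists N; exact: in_idealM.
have [N sN] : exists N, forall q, q \in s -> in_ideal (mkseq p N) q.
  elim: s sJ {Js} => [|q s IH] sJ; first by exists 0%N.
  have [|N sN] := IH; first by move=> y ys; apply: sJ; rewrite inE ys orbT.
  have [M qM] := sJ q (mem_head _ _).
  exists (maxn N M) => y; rewrite inE => /predU1P[->|/sN].
    exact: mono (leq_maxr _ _) qM.
  exact: mono (leq_maxl _ _).
have [|c pc] := Js (p N).
  by exists N.+1; apply: in_ideal_mem; apply: map_f; rewrite mem_iota /=.
have [d pd] : in_ideal (mkseq p N) (p N).
  by rewrite pc; apply: in_ideal_sum => i; apply/in_idealM/sN/mem_nth.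
exists N, d; rewrite {1}pd size_mkseq; apply: eq_bigr => i _.
by rewrite nth_mkseq.
Qed.
End Noetherian.

(** * Regular functions and affine charts *)

Section Germs.
Variables (K : closedFieldType) (X : prevariety K).
Implicit Types (U V W : opens X) (x y : X).

Lemma near_opens x (P : X -> Prop) :
  (\forall y \near x, P y) <-> exists U, oset U x /\ forall y, oset U y -> P y.
Proof.
rewrite -[X in X <-> _]/(nbhs x P) nbhsE; split=> [[A [oA Ax] AP]|[U [Ux UP]]].
  by exists (Opens oA).
by exists (oset U) => //; split=> //; exact: oset_open.
Qed.

Lemma opens_near U x : oset U x -> \forall y \near x, oset U y.
Proof. by move=> Ux; apply/near_opens; exists U. Qed.

Lemma near_open (A : set X) : (forall x, A x -> \forall y \near x, A y) -> open A.
Proof. by move=> h; rewrite openE => x /h. Qed.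

Lemma regular_at_eq x f g :
  (\forall y \near x, f y = g y) -> regular_at x f -> regular_at x g.
Proof.
move=> /near_opens[V [Vx VE]] [U [Ux rf]]; exists (opensI U V); split=> //.
apply: regular_ext (regular_res (opensIl U V) rf) => y [_ Vy]; exact: VE.
Qed.

Lemma regularP U f : regular U f <-> forall x, oset U x -> regular_at x f.
Proof.
split=> [rf x Ux|h]; first by exists U.
apply: regular_local => x Ux; have [V [Vx rf]] := h x Ux.
exists (opensI U V); split=> //; first exact: opensIl.
exact: regular_res (opensIr U V) rf.
Qed.

Lemma regular_atM x f g :
  regular_at x f -> regular_at x g -> regular_at x (fun y => f y * g y).
Proof.
move=> [U [Ux rf]] [V [Vx rg]]; exists (opensI U V); split=> //.
by apply: regularM; [apply: regular_res rf|apply: regular_res rg];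
  [exact: opensIl|exact: opensIr].
Qed.

Lemma regular_atB x f g :
  regular_at x f -> regular_at x g -> regular_at x (fun y => f y - g y).
Proof.
move=> rf rg; apply: regular_at_eq (regular_atD rf (regular_atZ (-1) rg)).
by apply: nearW => y; rewrite mulN1r.
Qed.

Lemma regular_at_sum x n (F : 'I_n -> X -> K) :
  (forall i, regular_at x (F i)) -> regular_at x (fun y => \sum_i F i y).
Proof.
elim: n F => [|n IH] F rF.
  by apply: regular_at_eq (regular_at_cst x 0); apply: nearW => y; rewrite big_ord0.
apply: regular_at_eq (regular_atD (rF ord0) (IH _ (fun i => rF (lift ord0 i)))).
by apply: nearW => y; rewrite big_ord_recl.
Qed.

Lemma regular_at_bigsum x (J : Type) (r : seq J) (F : J -> X -> K) :
  (forall i, regular_at x (F i)) -> regular_at x (fun y => \sum_(i <- r) F i y).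
Proof.
move=> rF; elim: r => [|i r IH].
  by apply: regular_at_eq (regular_at_cst x 0); apply: nearW => y; rewrite big_nil.
apply: regular_at_eq (regular_atD (rF i) IH).
by apply: nearW => y; rewrite big_cons.
Qed.

Lemma regular_at_bigprod x (J : Type) (r : seq J) (F : J -> X -> K) :
  (forall i, regular_at x (F i)) -> regular_at x (fun y => \prod_(i <- r) F i y).
Proof.
move=> rF; elim: r => [|i r IH].
  by apply: regular_at_eq (regular_at_cst x 1); apply: nearW => y; rewrite big_nil.
apply: regular_at_eq (regular_atM (rF i) IH).
by apply: nearW => y; rewrite big_cons.
Qed.

Lemma regular_atX x f k : regular_at x f -> regular_at x (fun y => f y ^+ k).
Proof.
move=> rf; elim: k => [|k IH].
  by apply: regular_at_eq (regular_at_cst x 1); apply: nearW => y; rewrite expr0.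
by apply: regular_at_eq (regular_atM rf IH); apply: nearW => y; rewrite exprS.
Qed.

Lemma regular_at_det x n (M : X -> 'M[K]_n) :
  (forall i j, regular_at x (fun y => M y i j)) -> regular_at x (fun y => \det (M y)).
Proof.
move=> rM; apply: regular_at_bigsum => s; apply: regular_atZ.
by apply: regular_at_bigprod => i; exact: rM.
Qed.

Lemma regular_at_adj x n (M : X -> 'M[K]_n) i j :
  (forall i j, regular_at x (fun y => M y i j)) ->
  regular_at x (fun y => (\adj (M y)) i j).
Proof.
move=> rM; apply: regular_at_eq (_ : regular_at x (fun y => cofactor (M y) j i)).
  by apply: nearW => y; rewrite mxE.
apply: regular_atZ; apply: regular_at_det => k l.
apply: regular_at_eq (rM (lift j k) (lift i l)).
by apply: nearW => y; rewrite !mxE.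
Qed.

(** Makes polynomials vanishing at a point combinations of differences of coordinates. For a
    product, p q - p(a) q(a) = (p - p(a)) q + p(a) (q - q(a)). *)
Lemma mpoly_taylor n (p : mpoly.mpoly n K) (a : 'I_n -> K) :
  exists g : 'I_n -> mpoly.mpoly n K, forall v : 'I_n -> K,
    meval v p = meval a p + \sum_i meval v (g i) * (v i - a i).
Proof.
elim/mpoly_alg_ind: p => [c|i|p q [g gE] [h hE]|p q [g gE] [h hE]].
- exists (fun=> 0) => v; rewrite !mevalC big1 ?addr0 // => i _.
  by rewrite mul0r.
- exists (fun j => if j == i then 1 else 0) => v; rewrite !mevalXU (bigD1 i) //= eqxx.
  rewrite meval1 mul1r big1 ?addr0; first by rewrite addrC subrK.
  by move=> j /negbTE /= ->; rewrite meval0 mul0r.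
- exists (fun i => g i + h i) => v; rewrite !mevalD gE hE addrACA -big_split /=.
  by congr (_ + _); apply: eq_bigr => i _; rewrite /= mevalD mulrDl.
- exists (fun i => g i * q + (meval a p) *: h i) => v.
  rewrite !mevalM (gE v) mulrDl {1}(hE v) mulrDr -addrA; congr (_ + _).
  rewrite mulr_sumr mulr_suml -big_split /=; apply: eq_bigr => i _.
  by rewrite /= mevalD mevalM mevalZ; ring.
Qed.

(* [affine] without the condition that the image of phi is closed. *)
Definition chart U n (phi : X -> 'I_n -> K) :=
  [/\ {in oset U &, injective phi},
      forall W : set X, W `<=` U ->
        (open W <->
         exists P, W = U `&` [set x | ~ zero_set P (phi x)])
    & forall (W : opens X) f, W `<=` U ->
        (regular W f <->
         forall x, oset W x -> exists p q, \forall y \near x,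
           mpoly.meval (phi y) q != 0 /\
           f y = mpoly.meval (phi y) p / mpoly.meval (phi y) q)].

Lemma affine_chart U : affine U -> exists n (phi : X -> 'I_n -> K), chart U phi.
Proof. by move=> [n [phi [S [h1 h2 h3 h4]]]]; exists n, phi; split. Qed.

Lemma chart_at x : exists U n (phi : X -> 'I_n -> K),
  [/\ oset U x, affine U & chart U phi].
Proof.
have [n [C [Caff Ccov]]] := pv_affine X; have [i Cx] := Ccov x.
have [m [phi ch]] := affine_chart (Caff i).
by exists (C i), m, phi.
Qed.

Section Chart.
Variables (U : opens X) (n : nat) (phi : X -> 'I_n -> K).
Hypothesis ch : chart U phi.

Lemma chart_nz_near x (q : mpoly.mpoly n K) : oset U x -> meval (phi x) q != 0 ->
  \forall y \near x, meval (phi y) q != 0.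
Proof.
case: ch => _ top _ Ux qx.
pose A := oset U `&` [set y | ~ zero_set [set q] (phi y)].
have oA : open A by apply/top; [move=> y []|exists [set q]].
apply/near_opens; exists (Opens oA); split.
  by split=> //= /(_ q erefl) /eqP; rewrite (negbTE qx).
by move=> y [_ /= qy]; apply/eqP => qy0; apply: qy => _ ->.
Qed.

Lemma chart_basis W x : W `<=` U -> oset W x -> exists b : mpoly.mpoly n K,
  meval (phi x) b != 0 /\
  forall y, oset U y -> meval (phi y) b != 0 -> oset W y.
Proof.
case: ch => _ top _ WU Wx; have /top[//|P PE] := oset_open W.
move: (Wx); rewrite PE => -[Ux /= /existsNP[b /not_implyP[Pb /eqP bx]]].
exists b; split=> // y Uy by0; split=> //= /(_ b Pb) /eqP.
by rewrite (negbTE by0).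
Qed.

Lemma chart_frac x f : oset U x -> regular_at x f <->
  exists p q, \forall y \near x, meval (phi y) q != 0 /\
     f y = meval (phi y) p / meval (phi y) q.
Proof.
case: ch => _ _ reg Ux; split=> [[V [Vx rf]]|[p [q /near_opens[V [Vx VE]]]]].
  have := reg (opensI U V) f (opensIl U V).
  by case=> + _; apply=> //; exact: regular_res (opensIr U V) rf.
exists (opensI U V); split=> //; apply/reg; first exact: opensIl.
move=> y [Uy Vy]; exists p, q; apply/near_opens; exists V; split=> // z Vz.
Qed.

Lemma chart_poly x p : oset U x -> regular_at x (fun y => meval (phi y) p).
Proof.
move=> Ux; apply/(chart_frac _ Ux); exists p, 1; apply: nearW => y.
by rewrite meval1 oner_neq0 divr1.
Qed.
End Chart.

Lemma regular_at_nz_near x f : regular_at x f -> f x != 0 ->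
  \forall y \near x, f y != 0.
Proof.
have [U [n [phi [Ux _ ch]]]] := chart_at x.
move=> /(chart_frac ch _ Ux) [p [q fE]] fx.
have [_ fxE] := nbhs_singleton fE.
have px : meval (phi x) p != 0.
  by apply: contra_neq fx; rewrite fxE => ->; rewrite mul0r.
apply: filterS2 fE (chart_nz_near ch Ux px) => y [qy ->] py.
by rewrite mulf_neq0 ?invr_neq0.
Qed.

Lemma regular_atV x f : regular_at x f -> f x != 0 ->
  regular_at x (fun y => (f y)^-1).
Proof.
have [U [n [phi [Ux _ ch]]]] := chart_at x.
move=> /(chart_frac ch _ Ux) [p [q fE]] fx; apply/(chart_frac ch _ Ux); exists q, p.
have [_ fxE] := nbhs_singleton fE.
have px : meval (phi x) p != 0.
  by apply: contra_neq fx; rewrite fxE => ->; rewrite mul0r.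
by apply: filterS2 fE (chart_nz_near ch Ux px) => y [qy ->] py; rewrite invf_div.
Qed.

Lemma regular_nz_open U f : regular U f -> open (oset U `&` [set x | f x != 0]).
Proof.
move=> rf; apply: near_open => x [Ux fx]; have rx : regular_at x f by exists U.
by apply: filterS2 (opens_near Ux) (regular_at_nz_near rx fx) => y.
Qed.

Definition opens_nz U f (rf : regular U f) : opens X := Opens (regular_nz_open rf).

(** * Principal open subsets of affine varieties *)

Section Rabinowitsch.
Variable n : nat.

Let ext (v : 'I_n -> K) (c : K) (i : 'I_n.+1) : K := oapp v c (unlift ord_max i).

Let ext_lift v c j : ext v c (lift ord_max j) = v j.
Proof. by rewrite /ext liftK. Qed.

Let ext_max v c : ext v c ord_max = c.
Proof. by rewrite /ext unlift_none. Qed.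

Let extE (w : 'I_n.+1 -> K) : w = ext (fun j => w (lift ord_max j)) (w ord_max).
Proof.
by apply/funext => i; case: (unliftP ord_max i) => [j|] ->; rewrite ?ext_lift ?ext_max.
Qed.

Let meval_ext v c (p : mpoly n K) : meval (ext v c) (mwiden p) = meval v p.
Proof.
elim/mpoly_alg_ind: p => [a|i|p q hp hq|p q hp hq].
- by rewrite mwidenC !mevalC.
- rewrite [mwiden _]mwidenX mnmwiden1 !mevalXU -(ext_lift v c i); congr ext.
  by apply: val_inj; rewrite /= /bump leqNgt ltn_ord.
- by rewrite mwidenD !mevalD hp hq.
- by rewrite mwidenM !mevalM hp hq.
Qed.

Let clear_denom (b : mpoly n K) (p : mpoly n.+1 K) : exists (q : mpoly n K) N,
  forall v c, c * meval v b = 1 -> meval (ext v c) p * meval v b ^+ N = meval v q.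
Proof.
elim/mpoly_alg_ind: p => [a|i|p p' [q [N qE]] [q' [N' qE']]|p p' [q [N qE]] [q' [N' qE']]].
- by exists (mpolyC n a), 0%N => v c _; rewrite !mevalC mulr1.
- case: (unliftP ord_max i) => [j ->|->].
    by exists (mpolyX K (mnm1 j)), 0%N => v c _; rewrite !mevalXU ext_lift mulr1.
  by exists 1, 1%N => v c e; rewrite mevalXU ext_max expr1 e meval1.
- exists (q * b ^+ N' + q' * b ^+ N), (N + N')%N => v c e.
  rewrite !mevalD !mevalM !rmorphXn /= -(qE v c e) -(qE' v c e) exprD; ring.
- exists (q * q'), (N + N')%N => v c e.
  rewrite !mevalM -(qE v c e) -(qE' v c e) exprD; ring.
Qed.

(** Rabinowitsch's trick: [(phi, 1/b)] embeds the locus b != 0 of U as the zero set of S and of b T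
    - 1, where T is the last variable. [clear_denom] brings polynomials involving T back to the old
    variables at the cost of a power of b, which is invertible there. *)
Lemma affine_principal (U V : opens X) (phi : X -> 'I_n -> K) (b : mpoly n K)
    (S : set (mpoly n K)) :
  chart U phi -> phi @` U = zero_set S ->
  (forall y, oset V y <-> oset U y /\ meval (phi y) b != 0) -> affine V.
Proof.
move=> ch im VE; have [inj top reg] := ch.
pose psi y := ext (phi y) (meval (phi y) b)^-1.
have Vb y : oset V y -> (meval (phi y) b)^-1 * meval (phi y) b = 1.
  by move=> /VE[_ by0]; rewrite mulVf.
pose S' := [set p | (exists2 q, S q & p = mwiden q) \/
                    p = mwiden b * mpolyX K (mnm1 ord_max) - 1].
exists n.+1, psi, S'; split.
- move=> x y; rewrite !inE => /VE[Ux _] /VE[Uy _] exy; apply: inj; rewrite ?inE //.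
  by apply/funext => j; have := congr1 (@^~ (lift ord_max j)) exy; rewrite /psi !ext_lift.
- apply/seteqP; split=> [_ [y Vy <-] p|w Sw].
    have [Uy by0] := (VE y).1 Vy; case=> [[q Sq ->]|->]; last first.
      by rewrite /psi mevalB mevalM meval1 meval_ext mevalXU ext_max divff ?subrr.
    rewrite meval_ext; have : zero_set S (phi y) by rewrite -im; exists y.
    exact.
  set v := fun j => w (lift ord_max j).
  have wE : w = ext v (w ord_max) := extE w.
  have [y Uy yv] : (phi @` U) v.
    rewrite im => p Sp; rewrite -(meval_ext v (w ord_max)) -wE.
    by apply: Sw; left; exists p.
  have e1 : meval v b * w ord_max = 1.
    have := Sw _ (or_intror erefl).
    rewrite mevalB mevalM meval1 mevalXU {1}wE meval_ext => /eqP.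
    by rewrite subr_eq0 => /eqP.
  have b0 : meval v b != 0.
    by apply: contra_eq_neq e1 => ->; rewrite mul0r eq_sym oner_neq0.
  exists y; first by apply/VE; rewrite yv.
  rewrite /psi yv [RHS]wE; congr ext.
  by apply: (mulfI b0); rewrite e1 divff.
- move=> W WV; have WU : W `<=` U by move=> y /WV /VE[].
  split=> [/top[//|P PE]|[P PE]].
    exists [set mwiden p | p in P]; apply/seteqP; split=> [y Wy|y [/= Vy h]].
      split=> /= [|h]; first exact: WV.
      move: Wy; rewrite PE => -[_ /=]; apply => p Pp.
      by rewrite -(meval_ext _ (meval (phi y) b)^-1); apply: h; exists p.
    rewrite PE; split=> /= [|h']; first by case/VE: Vy.
    by apply: h => _ [p Pp <-]; rewrite meval_ext; exact: h'.
  apply: near_open => y; rewrite PE => -[Vy /= /existsNP[p /not_implyP[Pp /eqP py]]].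
  have [q [N qE]] := clear_denom b p.
  have qy : meval (phi y) q != 0.
    by rewrite -(qE _ _ (Vb _ Vy)) mulf_neq0 ?expf_neq0 //; case/VE: Vy.
  have Uy : oset U y by case/VE: Vy.
  apply: filterS2 (opens_near Vy) (chart_nz_near ch Uy qy) => z Vz.
  rewrite -(qE _ _ (Vb _ Vz)) => qz; split=> //= /(_ p Pp) pz.
  by move: qz; rewrite /psi in pz *; rewrite pz mul0r eqxx.
- move=> W f WV; rewrite regularP.
  split=> h y Wy; have Vy := WV y Wy; have [Uy by0] := (VE y).1 Vy.
    have /(chart_frac ch _ Uy)[p [q pqE]] := h y Wy; exists (mwiden p), (mwiden q).
    by apply: filterS pqE => z; rewrite !meval_ext.
  have [p' [q' pqE]] := h y Wy; apply/(chart_frac ch _ Uy).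
  have [p [N pE]] := clear_denom b p'; have [q [M qE]] := clear_denom b q'.
  (* By [pE] and [qE], p' = p / b^N and q' = q / b^M, so p' / q' = (p b^M) / (q b^N). *)
  exists (p * b ^+ M), (q * b ^+ N); apply: filterS2 (opens_near Vy) pqE => z Vz.
  have [_ bz] := (VE z).1 Vz.
  rewrite !mevalM !rmorphXn /= -(pE _ _ (Vb _ Vz)) -(qE _ _ (Vb _ Vz)) => -[qz ->].
  rewrite -/(psi z); set B := meval (phi z) b in bz *.
  have [BN BM] : B ^+ N != 0 /\ B ^+ M != 0 by rewrite !expf_neq0.
  by split; [rewrite !mulf_neq0|field; rewrite BM BN qz].
Qed.
End Rabinowitsch.

(** The universal property of [kahler] is available on affine open sets only, so using it near a
    point requires affine neighbourhoods as small as desired. *)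
Lemma affine_basis U x : oset U x ->
  exists V, [/\ affine V, V `<=` U & oset V x].
Proof.
move=> Ux; have [U0 [_ [_ [U0x aff _]]]] := chart_at x.
have [n [phi [S [h1 h2 h3 h4]]]] := aff.
have ch : chart U0 phi by split.
have [b [bx bW]] := chart_basis ch (opensIr U U0) (conj Ux U0x).
have rb : regular U0 (fun y => meval (phi y) b).
  by apply/regularP => y Uy; exact: chart_poly ch _ _ _.
exists (opens_nz rb); split=> //.
- exact: (affine_principal (b := b) ch h2).
- by move=> y [/= U0y by0]; have [] := bW y U0y by0.
Qed.
End Germs.

(** * Local parameters *)

(** The determinant trick behind both uses of Nakayama's lemma: over K at each point near x, and
    over the functions on N acting on forms. *)
Lemma cramer_module (R : comPzRingType) (M : lmodType R) n (A : 'M[R]_n)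
    (w v : 'I_n -> M) : (forall i, \sum_j A i j *: w j = v i) ->
  forall k, \det A *: w k = \sum_i (\adj A) k i *: v i.
Proof.
move=> Aw k; under eq_bigr do rewrite -Aw scaler_sumr.
rewrite exchange_big /=.
transitivity (\sum_j (\det A)%:M k j *: w j).
  rewrite (bigD1 k) //= mxE eqxx mulr1n big1 ?addr0 // => j jk.
  by rewrite mxE eq_sym (negbTE jk) mulr0n scale0r.
apply: eq_bigr => j _; rewrite -mul_adj_mx mxE scaler_suml.
by apply: eq_bigr => i _; rewrite scalerA.
Qed.

Section LocalParameter.
Variables (K : closedFieldType) (X : prevariety K).
Implicit Types (U V W : opens X) (x y : X).

Lemma max_ideal_coords U n (phi : X -> 'I_n -> K) x f : chart U phi -> oset U x ->
  max_ideal x f -> exists g : 'I_n -> X -> K, (forall i, regular_at x (g i)) /\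
    \forall y \near x, f y = \sum_i g i y * (phi y i - phi x i).
Proof.
move=> ch Ux [/(chart_frac ch _ Ux)[p [q fE]] fx].
have [qx fxE] := nbhs_singleton fE.
have px : meval (phi x) p = 0.
  move: fxE; rewrite fx => /esym/eqP; rewrite mulf_eq0 invr_eq0 (negbTE qx) orbF.
  by move/eqP.
have [g gE] := mpoly_taylor p (phi x).
exists (fun i y => meval (phi y) (g i) * (meval (phi y) q)^-1); split.
  move=> i; apply: regular_atM; first exact: chart_poly ch _ _ _.
  by apply: regular_atV => //; exact: chart_poly ch _ _ _.
apply: filterS fE => y [_ ->]; rewrite gE px add0r mulr_suml.
by apply: eq_bigr => i _; rewrite mulrAC.
Qed.

Lemma coord_max_ideal U n (phi : X -> 'I_n -> K) x i : chart U phi -> oset U x ->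
  max_ideal x (fun y => phi y i - phi x i).
Proof.
move=> ch Ux; split; last by rewrite subrr.
apply: regular_atB; last exact: regular_at_cst.
apply: regular_at_eq (chart_poly ch (mpolyX K (mnm1 i)) Ux).
by apply: nearW => y; rewrite mevalXU.
Qed.

Section AtPoint.
Variables (x : X) (t : X -> K).
Hypothesis lp : local_parameter x t.

Lemma lp_regular : regular_at x t. Proof. by case: lp => -[]. Qed.
Lemma lp_0 : t x = 0. Proof. by case: lp => -[]. Qed.

(** If t vanished near x, both c = 0 and c = 1 would satisfy the condition on a local parameter for
    the function 0, against uniqueness. *)
Lemma lp_not_near0 : ~ \forall y \near x, t y = 0.
Proof.
move=> t0; have [_ /(_ (fun=> 0))[]] := lp.
  by split=> //; exact: regular_at_cst.
move=> c [_ cuniq]; have max2 a : max_ideal2 x (fun y => 0 - a * t y).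
  exists 0%N, (fun=> t), (fun=> t); split; [by case|by case|].
  by apply: filterS t0 => y ->; rewrite mulr0 subr0 big_ord0.
by have := oner_neq0 K; have := cuniq 1 (max2 1); rewrite (cuniq 0 (max2 0)) => <-; rewrite eqxx.
Qed.

(* Nakayama's lemma: the coordinates satisfy (1 - M) psi = t c with M = 0 at x. *)
Lemma coord_lp_divide U n (phi : X -> 'I_n -> K) i : chart U phi -> oset U x ->
  exists2 u, regular_at x u & \forall y \near x, phi y i - phi x i = u y * t y.
Proof.
move=> ch Ux; pose psi j y := phi y j - phi x j.
(* psi_j - c_j t lies in the square of the maximal ideal; expanding the second factor of each
   product in the coordinates gives row j of M. *)
have ex j : exists (c : K) (M : 'I_n -> X -> K),
    [/\ forall k, regular_at x (M k), forall k, M k x = 0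
      & \forall y \near x, psi j y - \sum_k M k y * psi k y = c * t y].
  have [_ /(_ _ (coord_max_ideal j ch Ux)) [c [[m [a [b [ha hb hab]]]] _]]] := lp.
  have [g gP] := choice (fun k => max_ideal_coords ch Ux (hb k)).
  exists c, (fun l y => \sum_k a k y * g k l y); split.
  - move=> l; apply: regular_at_sum => k; apply: regular_atM; first by case: (ha k).
    by case: (gP k).
  - by move=> l; rewrite big1 // => k _; case: (ha k) => _ ->; rewrite mul0r.
  have hg : \forall y \near x, forall k, b k y = \sum_l g k l y * psi l y.
    by apply: filter_forall => k; case: (gP k).
  apply: filterS2 hab hg => y hy gy.
  have -> : psi j y = \sum_k a k y * b k y + c * t y by rewrite -hy subrK.
  rewrite addrAC [X in X + _](_ : _ = 0) ?add0r //; apply/eqP; rewrite subr_eq0.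
  apply/eqP; under eq_bigr do rewrite gy mulr_sumr.
  rewrite exchange_big; apply: eq_bigr => l _; rewrite mulr_suml.
  by apply: eq_bigr => k _; rewrite mulrA.
have [c /choice[M MP]] := choice ex.
pose A y : 'M[K]_n := \matrix_(j, k) ((j == k)%:R - M j k y).
have rA j k : regular_at x (fun y => A y j k).
  have [rM _ _] := MP j.
  apply: regular_at_eq (regular_atB (regular_at_cst x (j == k)%:R) (rM k)).
  by apply: nearW => y; rewrite mxE.
have rdet := regular_at_det rA.
have detx : \det (A x) != 0.
  suff -> : A x = 1%:M by rewrite det1 oner_neq0.
  by apply/matrixP => j k; have [_ M0 _] := MP j; rewrite !mxE M0 subr0.
exists (fun y => (\sum_k (\adj (A y)) i k * c k) * (\det (A y))^-1).
  apply: regular_atM; last exact: regular_atV.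
  apply: regular_at_sum => k; apply: regular_atM; last exact: regular_at_cst.
  exact: regular_at_adj.
have hM : \forall y \near x, forall j, psi j y - \sum_k M j k y * psi k y = c j * t y.
  by apply: filter_forall => j; case: (MP j).
apply: filterS2 hM (regular_at_nz_near rdet detx) => y hy dy.
have := @cramer_module K K^o n (A y) (psi^~ y) (fun j => c j * t y).
move=> /(_ _ i) h; apply: (mulfI dy); rewrite [LHS]h.
  rewrite mulrA [_ * (_ / _)]mulrCA divff // mulr1 mulr_suml.
  by apply: eq_bigr => k _; rewrite -mulrA.
move=> j; rewrite -hy; under eq_bigr do rewrite mxE scalerBl.
rewrite sumrB (bigD1 j) //= eqxx scale1r big1 ?addr0 // => k kj.
by rewrite eq_sym (negbTE kj) scale0r.
Qed.

Lemma lp_divide f : max_ideal x f ->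
  exists2 u, regular_at x u & \forall y \near x, f y = u y * t y.
Proof.
move=> mf; have [U [n [phi [Ux _ ch]]]] := chart_at x.
have [g [rg fE]] := max_ideal_coords ch Ux mf.
have ex i : exists u, regular_at x u /\
    \forall y \near x, phi y i - phi x i = u y * t y.
  by have [u] := coord_lp_divide i ch Ux; exists u.
have [u uP] := choice ex.
exists (fun y => \sum_i g i y * u i y).
  by apply: regular_at_sum => i; apply: regular_atM => //; case: (uP i).
have hu : \forall y \near x, forall i, phi y i - phi x i = u i y * t y.
  by apply: filter_forall => i; case: (uP i).
apply: filterS2 fE hu => y -> uy; rewrite mulr_suml.
by apply: eq_bigr => i _; rewrite uy mulrA.
Qed.

(** Where t vanishes, so do all differences of coordinates, which t divides; the chart is
    injective. *)
Lemma lp_isolated_zero : \forall y \near x, t y = 0 -> y = x.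
Proof.
have [U [n [phi [Ux _ ch]]]] := chart_at x; have [inj _ _] := ch.
have hu : \forall y \near x, forall i, exists u, phi y i - phi x i = u * t y.
  apply: filter_forall => i; have [u _] := coord_lp_divide i ch Ux.
  by apply: filterS => y ->; exists (u y).
apply: filterS2 (opens_near Ux) hu => y Uy uy ty.
apply: inj; rewrite ?inE //; apply/funext => i; have [u] := uy i.
by rewrite ty mulr0 => /eqP; rewrite subr_eq0 => /eqP.
Qed.

(** At y either f y = 0 or t y = 0. If f x = 0, then f = u t makes f y vanish in both cases; if f x
    != 0, then t would vanish near x. *)
Lemma lp_nonzerodivisor f : regular_at x f ->
  (\forall y \near x, f y * t y = 0) -> \forall y \near x, f y = 0.
Proof.
move=> rf ft0; have [fx|fx] := eqVneq (f x) 0.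
  have [u ru fE] := lp_divide (conj rf fx).
  apply: filterS2 ft0 fE => y /eqP; rewrite mulf_eq0 => /orP[/eqP//|/eqP->] ->.
  by rewrite mulr0.
case: lp_not_near0; apply: filterS2 ft0 (regular_at_nz_near rf fx) => y /eqP.
by rewrite mulf_eq0 => /orP[->|/eqP].
Qed.

Lemma lp_expn_nonzerodivisor f k : regular_at x f ->
  (\forall y \near x, f y * t y ^+ k = 0) -> \forall y \near x, f y = 0.
Proof.
elim: k f => [|k IH] f rf; first by apply: filterS => y; rewrite expr0 mulr1.
move=> h; apply: lp_nonzerodivisor => //; apply: IH.
  by apply: regular_atM => //; exact: lp_regular.
by apply: filterS h => y; rewrite exprS mulrA.
Qed.

(* Krull's intersection theorem: if t^k divides f for all k, then the quotients
   v k generate an ascending chain of ideals, and it stabilizes. *)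
Lemma lp_factor f : regular_at x f -> (\forall y \near x, f y = 0) \/
  exists k u, [/\ regular_at x u, u x != 0 & \forall y \near x, f y = u y * t y ^+ k].
Proof.
move=> rf; have [?|nfac] := pselect (exists k u,
  [/\ regular_at x u, u x != 0 & \forall y \near x, f y = u y * t y ^+ k]).
  by right.
left; have ex k : exists v, regular_at x v /\ \forall y \near x, f y = v y * t y ^+ k.
  elim: k => [|k [v [rv fE]]].
    by exists f; split=> //; apply: nearW => y; rewrite expr0 mulr1.
  have vx : v x = 0 by apply: contrapT => /eqP vx; apply: nfac; exists k, v.
  have [u ru vE] := lp_divide (conj rv vx); exists u; split=> //.
  by apply: filterS2 fE vE => y -> ->; rewrite exprS mulrA.
have [v vP] := choice ex.
have vD k l : \forall y \near x, v k y = t y ^+ l * v (k + l)%N y.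
  have [rk fk] := vP k; have [rl fl] := vP (k + l)%N.
  have : \forall y \near x, v k y - t y ^+ l * v (k + l)%N y = 0.
    apply: (lp_expn_nonzerodivisor (k := k)).
      by apply: regular_atB => //; apply: regular_atM => //; apply/regular_atX/lp_regular.
    apply: filterS2 fk fl => y fk fl; rewrite mulrBl -fk {1}fl exprD; ring.
  by apply: filterS => y /eqP; rewrite subr_eq0 => /eqP.
have [U [n [phi [Ux _ ch]]]] := chart_at x.
have ex' k : exists pq : mpoly n K * mpoly n K, \forall y \near x,
    meval (phi y) pq.2 != 0 /\ v k y = meval (phi y) pq.1 / meval (phi y) pq.2.
  have [rv _] := vP k; have /(chart_frac ch _ Ux)[p [q E]] := rv.
  by exists (p, q).
have [pq pqP] := choice ex'.
have [N [c cE]] := noetherian_seq (fst \o pq) (noetherian_mpoly (K := K) (n := n)).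
pose q k y := meval (phi y) (pq k).2.
have rq k : regular_at x (q k) by exact: chart_poly ch _ _ _.
(* The numerators satisfy p_N = sum c_i p_i, with p_i = v_i q_i and v_i = t^(N - i) v_N, so v_N G =
   0. As t x = 0, G x = q_N x is nonzero, hence v_N = 0 and f = v_N t^N = 0 near x. *)
pose G y := q N y - \sum_(i < N) meval (phi y) (c i) * q i y * t y ^+ (N - i).
have rG : regular_at x G.
  apply: regular_atB => //; apply: regular_at_sum => i.
  apply: regular_atM; last exact/regular_atX/lp_regular.
  by apply: regular_atM => //; exact: chart_poly ch _ _ _.
have Gx : G x != 0.
  rewrite /G big1 ?subr0; first by case: (nbhs_singleton (pqP N)).
  by move=> i _; rewrite lp_0 expr0n subn_eq0 leqNgt ltn_ord mulr0.
have h1 : \forall y \near x, forall i : 'I_N, v i y * q i y = meval (phi y) (pq i).1.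
  by apply: filter_forall => i; apply: filterS (pqP i) => y [qy ->]; rewrite divfK.
have h2 : \forall y \near x, forall i : 'I_N, v i y = t y ^+ (N - i) * v N y.
  apply: filter_forall => i; have := vD i (N - i)%N.
  by rewrite subnKC // ltnW.
have vN0 : \forall y \near x, v N y = 0.
  have h3 : \forall y \near x, v N y * G y = 0.
    apply: filterS3 h1 h2 (pqP N) => y h1 h2 [qN vN].
    rewrite /G mulrBr {1}vN divfK // [(pq N).1]cE raddf_sum /= mulr_sumr -sumrB big1 //.
    by move=> i _; rewrite mevalM -h1 h2; ring.
  apply: filterS2 h3 (regular_at_nz_near rG Gx) => y /eqP.
  by rewrite mulf_eq0 => /orP[/eqP//|->].
have [_ fN] := vP N.
by apply: filterS2 fN vN0 => y -> ->; rewrite mul0r.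
Qed.

(** A germ f other than 0 is a unit times a power of t, and such a power is not a zero divisor. *)
Lemma germ_domain f g : regular_at x f -> regular_at x g ->
  (\forall y \near x, f y * g y = 0) ->
  (\forall y \near x, f y = 0) \/ (\forall y \near x, g y = 0).
Proof.
move=> rf rg fg0; have [|[k [u [ru ux fE]]]] := lp_factor rf; first by left.
right; have : \forall y \near x, g y * t y ^+ k = 0.
  apply: filterS3 fg0 fE (regular_at_nz_near ru ux) => y h1 h2 uy; move/eqP: h1.
  by rewrite h2 -mulrA mulf_eq0 (negbTE uy) /= mulrC => /eqP.
exact: lp_expn_nonzerodivisor.
Qed.
End AtPoint.

(** Finitely many generators show that all polynomials vanishing near x vanish on one neighbourhood
    N. If z in N were outside the closure of V, there would be polynomials a and b with a b = 0 on
    U, a nonzero at a point of V in N and b nonzero at z. The local ring at x being a domain, one of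
    them vanishes near x, hence on N. *)
Lemma closure_open_at x t (V : opens X) : local_parameter x t ->
  closure (oset V) x -> \forall y \near x, closure (oset V) y.
Proof.
move=> lp clx; have [U [n [phi [Ux _ ch]]]] := chart_at x.
have [|s [sJ Js]] := noetherian_mpoly
    (I := [set p : mpoly n K | \forall y \near x, meval (phi y) p = 0]).
  split=> /=.
  - by apply: nearW => y; rewrite meval0.
  - by move=> p q; apply: filterS2 => y; rewrite mevalD => -> ->; rewrite addr0.
  - by move=> a p; apply: filterS => y; rewrite mevalM => ->; rewrite mulr0.
have : \forall y \near x, forall i : 'I_(size s), meval (phi y) s`_i = 0.
  by apply: filter_forall => i; apply/sJ/mem_nth.
move=> /near_opens[N [Nx NE]].
have JN p : (\forall y \near x, meval (phi y) p = 0) ->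
    forall y, oset N y -> meval (phi y) p = 0.
  move=> /Js[c ->] y Ny; rewrite raddf_sum big1 //= => i _.
  by rewrite mevalM NE // mulr0.
apply: filterS2 (opens_near Ux) (opens_near Nx) => z Uz Nz.
apply: contrapT => nz.
pose V' : opens X := Opens (closed_openC (@closed_closure _ (oset V))).
have [b [bz bV']] := chart_basis ch (opensIr V' U) (conj nz Uz).
pose W := opensI V (opensI U N).
have [y0 [Vy0 Wy0]] : (oset V `&` oset (opensI U N)) !=set0.
  apply: clx; apply: open_nbhs_nbhs; split; first exact: oset_open.
  by split.
have WU : W `<=` U by move=> y [_ []].
have [a [ay0 aV]] := chart_basis ch WU (conj Vy0 Wy0).
have [|/JN|/JN] := germ_domain lp (chart_poly ch a Ux) (chart_poly ch b Ux).
- apply: filterS (opens_near Ux) => y Uy; apply/eqP; rewrite mulf_eq0.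
  apply/norP => -[ay by0]; have [Vy _] := aV y Uy ay.
  by have [/= nV _] := bV' y Uy by0; apply: nV; exact: subset_closure.
- by move=> /(_ y0); case: Wy0 => _ Ny0 /(_ Ny0)/eqP; rewrite (negbTE ay0).
- by move=> /(_ z Nz)/eqP; rewrite (negbTE bz).
Qed.

Lemma connected_smooth_irreducible : connected [set: X] ->
  (forall x : X, exists t, local_parameter x t) ->
  forall U, oset U !=set0 -> dense U.
Proof.
move=> conX lpX U [x0 Ux0]; have clT : closure (oset U) = [set: X].
  apply: conX.
  - by exists x0; exact: subset_closure.
  - exists (closure (oset U)); last by rewrite setTI.
    apply: near_open => x clx; have [t lp] := lpX x.
    exact: closure_open_at lp clx.
  - by exists (closure (oset U)); [exact: closed_closure|rewrite setTI].
move=> A [x Ax] oA; have : closure (oset U) x by rewrite clT.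
by move=> /(_ A) []; [exact: open_nbhs_nbhs|move=> y [Uy Ay]; exists y].
Qed.
End LocalParameter.

(** * Subquotients and sheaves *)

Section Quotmod.
Variables (R : pzRingType) (V : lmodType R).

Lemma quotmod_eq (W : submodule V) (u v : V) :
  \pi_(quotmod W) u = \pi_(quotmod W) v <-> smem W (u - v).
Proof.
split=> [/eqP|h]; last apply/eqP.
  by rewrite -[_ == _]/(_ == _ :> Quotient.quot _) -Quotient.idealrBE => /asboolP.
by rewrite -[_ == _]/(_ == _ :> Quotient.quot _) -Quotient.idealrBE; apply/asboolP.
Qed.

Lemma quotmod_pi_linear (W : submodule V) : linear (\pi_(quotmod W) : V -> quotmod W).
Proof.
move=> a u v; rewrite -quotmod_piD; congr (_ + _).
by rewrite -quotmod_scale_pi.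
Qed.

Lemma quotmod_pi0 (W : submodule V) (u : V) :
  \pi_(quotmod W) u = 0 <-> smem W u.
Proof.
have e0 : \pi_(quotmod W) 0 = 0.
  have := quotmod_pi_linear W 1 0 0.
  by rewrite !scale1r add0r => /esym; rewrite -{3}[\pi_(quotmod W) 0]add0r => /addIr.
by rewrite -[X in _ = X]e0 quotmod_eq subr0.
Qed.
End Quotmod.

Section SubquotIso.
Variables (R : pzRingType) (V V' : lmodType R).
Variables (Z B : submodule V) (Z' B' : submodule V').

Let mk (v : V) (Zv : smem Z v) : submod Z :=
  exist (fun v => v \in smem_pred Z) v (introT (asboolP _) Zv).

(** A linear relation replaces a map on cycles. Read from left to right, [PB] applied to differences
    makes the class of u' independent of all choices; read from right to left, it gives
    injectivity. *)
Lemma subquot_rel_iso (P : V -> V' -> Prop) :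
  (forall a u v u' v', P u u' -> P v v' -> P (a *: u + v) (a *: u' + v')) ->
  (forall u, smem Z u -> exists2 u', smem Z' u' & P u u') ->
  (forall u', smem Z' u' -> exists u v',
     [/\ smem Z u, smem Z' v', P u v' & smem B' (u' - v')]) ->
  (forall u u', smem Z u -> smem Z' u' -> P u u' -> smem B u <-> smem B' u') ->
  exists phi : {linear subquot Z B -> subquot Z' B'}, bijective phi.
Proof.
move=> PL Ptot Psur PB.
have ZP (u : submod Z) : smem Z (val u) by have /asboolP := valP u.
have Z'P (u : submod Z') : smem Z' (val u) by have /asboolP := valP u.
have ex (q : subquot Z B) : exists q' : subquot Z' B',
    exists (u : submod Z) (u' : submod Z'),
      [/\ q = \pi u, q' = \pi u' & P (val u) (val u')].
  elim/quotW: q => u; have [u' Zu' Puu'] := Ptot _ (ZP u).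
  pose w : submod Z' :=
    exist (fun v => v \in smem_pred Z') u' (introT (asboolP _) Zu').
  by exists (\pi w), u, w.
have [f fP] := choice ex.
have fE (u : submod Z) (u' : submod Z') : P (val u) (val u') ->
    f (\pi_(subquot Z B) u) = \pi_(subquot Z' B') u'.
  move=> Puu'; case: (fP (\pi_(subquot Z B) u)) => v [v' [uv -> Pvv']].
  apply/quotmod_eq => /=.
  have /PB : P (val v - val u) (val v' - val u').
    rewrite addrC [val v' - _]addrC -!scaleN1r.
    exact: PL.
  move=> /(_ (ZP (v - u)) (Z'P (v' - u'))) [+ _]; apply.
  by move/esym/quotmod_eq: uv.
have flin : linear f.
  move=> a q r; case: (fP q) => u [u' [-> -> Pu]].
  case: (fP r) => v [v' [-> -> Pv]].
  rewrite -(quotmod_pi_linear (trace_submodule Z B) a u v).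
  rewrite -(quotmod_pi_linear (trace_submodule Z' B') a u' v').
  by apply: fE; rewrite !linearP; exact: PL.
pose F : {linear subquot Z B -> subquot Z' B'} :=
  HB.pack f (GRing.isLinear.Build R (subquot Z B) (subquot Z' B') _ f flin).
exists F.
have finj : injective f.
  apply: (raddf_inj (f := F)) => q /=; case: (fP q) => u [u' [-> -> Pu]].
  move=> /(@quotmod_pi0 _ _ (trace_submodule Z' B')) /=.
  move=> /(PB _ _ (ZP u) (Z'P u') Pu) Bu.
  exact/(@quotmod_pi0 _ _ (trace_submodule Z B)).
have fsur q' : exists q, f q = q'.
  elim/quotW: q' => u'; have [u [v' [Zu Zv' Puv' Buv]]] := Psur _ (Z'P u').
  pose w' : submod Z' :=
    exist (fun v => v \in smem_pred Z') v' (introT (asboolP _) Zv').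
  exists (\pi_(subquot Z B) (mk Zu)); rewrite (fE _ w') //.
  exact/esym/quotmod_eq.
have [g gP] := choice fsur.
by exists g => // q; apply: finj; rewrite gP.
Qed.
End SubquotIso.

Section SheafLocal.
Variables (K : fieldType) (T : topologicalType).
Implicit Types (F G : sheaf K T) (U V W : opens T).

Lemma sheaf_eq F U (s t : F U) :
  (forall x, oset U x -> exists V (h : V `<=` U), oset V x /\ res h s = res h t) ->
  s = t.
Proof.
move=> st; apply/eqP; rewrite -subr_eq0; apply/eqP.
have cov : open_cover U [set V : opens T | V `<=` U /\ forall h : V `<=` U, res h (s - t) = 0].
  split=> [V []//|x Ux]; have [V [h [Vx e]]] := st x Ux.
  exists V => //; split=> // k.
  by rewrite (Prop_irrelevance k h) linearB /= e subrr.
by apply: (sheaf_sep cov) => V h [_]; exact.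
Qed.

(** Here the sections to glue are given by a property, where [sheaf_glue] wants one section for
    every open set. Compatibility for V = V' makes them unique. *)
Lemma sheaf_glue_rel F U (R : forall V, F V -> Prop) :
  (forall x, oset U x -> exists V (s : F V), [/\ V `<=` U, oset V x & R V s]) ->
  (forall V V' (s : F V) (s' : F V'), V `<=` U -> V' `<=` U -> R V s -> R V' s' ->
     res (opensIl V V') s = res (opensIr V V') s') ->
  exists t : F U, forall V (h : V `<=` U) (s : F V), R V s -> res h t = s.
Proof.
move=> Rex Rcompat.
have ex V : exists s : F V, (exists s', R V s') -> R V s.
  by have [[s Rs]|nR] := pselect (exists s, R V s); [exists s|exists 0].
have [s sP] : {s : forall V, F V | forall V, (exists s', R V s') -> R V (s V)}.
  exists (fun V => projT1 (cid (ex V))) => V; exact: (projT2 (cid (ex V))).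
pose C := [set V : opens T | V `<=` U /\ exists s', R V s'].
have cov : open_cover U C.
  split=> [V []//|x Ux]; have [V [s' [VU Vx RV]]] := Rex x Ux.
  by exists V => //; split=> //; exists s'.
have [|t tP] := @sheaf_glue _ _ F U C cov s.
  move=> V V' W h h' [VU RV] [VU' RV'].
  have WI : W `<=` opensI V V' by move=> x Wx; split; [exact: h|exact: h'].
  rewrite -(res_res (opensIl V V') WI h) -(res_res (opensIr V V') WI h').
  by congr (res WI _); apply: Rcompat => //; exact: sP.
exists t => V h s' Rs'; rewrite tP; last by split=> //; exists s'.
have /= := Rcompat V V (s V) s' h h (sP V (ex_intro _ _ Rs')) Rs'.
have k : V `<=` opensI V V by [].
move=> /(congr1 (res k)).
by rewrite (res_res _ _ (@subset_refl _ _)) (res_res _ _ (@subset_refl _ _)) !res_id.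
Qed.

(** The condition under which sections over a dense open set embed in the rational sections. *)
Definition torsion_free F :=
  forall U V (h : V `<=` U) (s : F U), oset V !=set0 -> res h s = 0 -> s = 0.

Lemma dense_neq0 U : [set: T] !=set0 -> dense U -> oset U !=set0.
Proof.
move=> T0 dU; have [x []] := dU setT T0 openT.
by exists x.
Qed.

Lemma rat_inj F U (dU : dense U) (s t : F U) :
  [set: T] !=set0 -> torsion_free F -> rat dU s = rat dU t -> s = t.
Proof.
move=> T0 tF /ratP[W [/= h [k [dW e]]]].
apply/eqP; rewrite -subr_eq0; apply/eqP/(tF _ _ h (s - t) (dense_neq0 T0 dW)).
by rewrite linearB /= e (Prop_irrelevance k h) subrr.
Qed.

Lemma rat_map_linear F G (f : sheaf_hom F G) : linear (rat_map f).
Proof.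
move=> a u v; have [U [dU [s [t [-> ->]]]]] := ratE2 u v.
by rewrite ratZ ratD !rat_mapE ratZ ratD linearP.
Qed.

HB.instance Definition _ F G (f : sheaf_hom F G) :=
  GRing.isLinear.Build K (ratsec F) (ratsec G) _ (rat_map f) (rat_map_linear f).

Lemma rat_linear F U (dU : dense U) : linear (@rat K T F U dU).
Proof. by move=> a s t; rewrite ratZ ratD. Qed.

HB.instance Definition _ F U (dU : dense U) :=
  GRing.isLinear.Build K (F U) (ratsec F) _ (@rat K T F U dU) (@rat_linear F U dU).

Definition fun_res (M : lmodType K) U V (h : V `<=` U)
    (s : {x | oset U x} -> M) : {x | oset V x} -> M :=
  fun p => s (exist _ (sval p) (h _ (svalP p))).

Fact fun_res_linear (M : lmodType K) U V (h : V `<=` U) : linear (@fun_res M U V h).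
Proof. by []. Qed.

HB.instance Definition _ (M : lmodType K) U V (h : V `<=` U) :=
  GRing.isLinear.Build K ({x | oset U x} -> M) ({x | oset V x} -> M) _
    (@fun_res M U V h) (@fun_res_linear M U V h).

(** All functions on the points of U, so gluing is pointwise. Functions on the subtype, rather than
    extensions by 0, inherit the module structure of a function space. *)
Definition fun_sheaf (M : lmodType K) : sheaf K T.
Proof.
unshelve refine (@Sheaf K T (fun U => ({x | oset U x} -> M) : lmodType K)
  (fun U V h => @fun_res M U V h) _ _ _ _).
- move=> U h s; apply/funext => -[x Ux].
  by rewrite /= /fun_res /=; congr (s (exist _ _ _)); exact: Prop_irrelevance.
- move=> U V W h k l s; apply/funext => -[x Wx].
  by rewrite /= /fun_res /=; congr (s (exist _ _ _)); exact: Prop_irrelevance.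
- move=> U C [CU UC] s s0; apply/funext => -[x Ux].
  have [V CV Vx] := UC x Ux.
  have /(congr1 (fun f => f (exist _ x Vx))) := s0 V (CU V CV) CV.
  move=> e; apply: etrans e; rewrite /= /fun_res /=.
  by congr (s (exist _ _ _)); exact: Prop_irrelevance.
- move=> U C [CU UC] s sC.
  exists (fun p => let: exist2 V _ h := cid2 (UC _ (svalP p)) in
                   s V (exist _ (sval p) h)).
  move=> V h CV; apply/funext => -[x Vx]; rewrite /= /fun_res /=.
  case: (cid2 _) => /= V' CV' V'x.
  have /(congr1 (fun f => f (exist _ x (conj V'x Vx)))) :=
    sC V' V (opensI V' V) (opensIl V' V) (opensIr V' V) CV' CV.
  rewrite /= /fun_res /= => e.
  by apply: (etrans (etrans _ e)); congr (s _ (exist _ _ _)); exact: Prop_irrelevance.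
Defined.
End SheafLocal.

(** * From second kind forms to hypercohomology *)

Lemma addr_cross (V : zmodType) (a b a' b' : V) :
  a + b = a' + b' <-> a - a' = b' - b.
Proof.
split=> [/(canRL (addrK _))-> |/(canRL (subrK _))->].
  by rewrite addrAC [a' + _]addrC addrK.
by rewrite addrAC subrK addrC.
Qed.

Section Main.
Variables (K : closedFieldType) (X : prevariety K) (Om : kahler X).
Variable I : injective_resolution (de_rham Om).
Implicit Types (U V W : opens X).

Let O := regular_sheaf X.
Let R1 := ratsec Om.

Hypothesis X0 : [set: X] !=set0.
Hypothesis irr : forall U, oset U !=set0 -> dense U.
Hypothesis tfO : torsion_free O.
Hypothesis tfOm : torsion_free Om.
Hypothesis regd : forall U (dU : dense U) (g : function_field X) (w : Om U),
  rat_map (kd Om) g = rat dU w -> exists s : O U, g = rat dU s.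

Definition locally_form_exact (w : R1) := forall x : X, exists U (dU : dense U)
  (u : Om U) (f : function_field X), oset U x /\ w = rat dU u + rat_map (kd Om) f.

Hypothesis skP : forall w, smem (second_kind Om) w <-> locally_form_exact w.

Let iota n : sheaf_hom (de_rham Om n) (I n) := ir_map I n.
Let iota0 : sheaf_hom O (I 0%N) := iota 0.
Let iota1 : sheaf_hom Om (I 1%N) := iota 1.
Let d0 U : {linear I 0%N U -> I 1%N U} := cx_d I 0 U.

Let iotad U (s : O U) : iota1 U (kd Om U s) = d0 U (iota0 U s).
Proof. exact: (@chom_d _ _ _ _ (ir_map I) 0%N U s). Qed.

Let B : sheaf K X := fun_sheaf X (ratsec O).

(** The density proof that [rat] requires comes from the point p at which the function is evaluated,
    so the empty set needs no separate case. *)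
Let jfun U (s : O U) : B U :=
  fun p => rat (irr (ex_intro _ (sval p) (svalP p))) s.

Let jfun_linear U : linear (@jfun U).
Proof. by move=> a s t; apply/funext => p; rewrite /jfun -ratD -ratZ. Qed.

Let jlin U : {linear O U -> B U} :=
  HB.pack (@jfun U) (GRing.isLinear.Build K (O U) (B U) _ (@jfun U) (@jfun_linear U)).

Let jres U V (h : V `<=` U) (s : O U) : jlin V (res h s) = res h (jlin U s).
Proof. by apply/funext => -[x Vx]; exact: rat_res. Qed.

Let j : sheaf_hom O B := @SheafHom K X O B jlin jres.

Let jinj U : injective (j U).
Proof.
apply: raddf_inj => s s0; apply: regfun_eq => x Ux.
have dU := irr (ex_intro _ x Ux).
have /(rat_inj X0 tfO) -> // : rat dU s = rat dU (0 : O U).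
rewrite -rat0; have /(congr1 (fun f => f (exist _ x Ux))) := s0.
move=> e; apply: (etrans _ e); rewrite /= /jfun; congr (rat _ s); exact: Prop_irrelevance.
Qed.

Section Extension.
Variable e : sheaf_hom B (I 0%N).
Hypothesis ej : forall U (s : O U), e U (j U s) = iota0 U s.

Let E U (f : function_field X) : I 0%N U := e U (fun=> f).

Let E_linear U : linear (@E U).
Proof. by move=> a f g; rewrite -linearP. Qed.

HB.instance Definition _ U := GRing.isLinear.Build K (function_field X) (I 0%N U)
  _ (@E U) (@E_linear U).

Let E_res U V (h : V `<=` U) f : res h (E U f) = E V f.
Proof. by rewrite /E -shom_res. Qed.

(** As a K(X)-valued function, [j s] is constant with value the class of s; thus E extends iota0. *)
Let E_rat U (dU : dense U) (s : O U) : E U (rat dU s) = iota0 U s.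
Proof.
rewrite -ej /E; congr (e U _); apply/funext => p.
by rewrite /= /jfun; congr (rat _ s); exact: Prop_irrelevance.
Qed.

(* i is the image of w under the extension of iota^1 from Omega^1 to the sheaf of
   forms of the second kind. *)
Let glued (w : R1) (i : I 1%N (opensT X)) := forall x : X,
  exists U (h : U `<=` opensT X) (dU : dense U) (u : Om U) (f : function_field X),
    [/\ oset U x, w = rat dU u + rat_map (kd Om) f
      & res h i = iota1 U u + d0 U (E U f)].

Let decompE w U (dU : dense U) (u u' : Om U) (f f' : function_field X) :
  w = rat dU u + rat_map (kd Om) f -> w = rat dU u' + rat_map (kd Om) f' ->
  iota1 U u + d0 U (E U f) = iota1 U u' + d0 U (E U f').
Proof.
move=> -> /addr_cross; rewrite -!linearB /= => e1.
have [s es] := regd (esym e1).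
move: e1; rewrite es rat_mapE => /(rat_inj X0 tfOm) eu.
by apply/addr_cross; rewrite -!linearB /= eu iotad es E_rat.
Qed.

Let decompE2 w U V W (hU : W `<=` U) (hV : W `<=` V) (dU : dense U) (dV : dense V)
    (dW : dense W) (u : Om U) (u' : Om V) (f f' : function_field X) :
  w = rat dU u + rat_map (kd Om) f -> w = rat dV u' + rat_map (kd Om) f' ->
  res hU (iota1 U u + d0 U (E U f)) = res hV (iota1 V u' + d0 V (E V f')).
Proof.
rewrite -(rat_res dU dW hU) -(rat_res dV dW hV) => eU eV.
by rewrite !linearD /= -!shom_res; exact: (decompE eU eV).
Qed.

Let gluedE w i : glued w i -> forall U (h : U `<=` opensT X) (dU : dense U)
  (u : Om U) (f : function_field X), w = rat dU u + rat_map (kd Om) f ->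
  res h i = iota1 U u + d0 U (E U f).
Proof.
move=> gwi U h dU u f ew; apply: sheaf_eq => x Ux.
have [V [k [dV [u' [f' [Vx ew' ei]]]]]] := gwi x.
exists (opensI U V), (opensIl U V); split=> //.
have hW : opensI U V `<=` opensT X by [].
rewrite (res_res _ _ hW) -(res_res k (opensIr U V) hW) ei.
apply: (decompE2 _ _ (irr _) ew' ew); by exists x.
Qed.

Let glued_linear a v w i k : glued v i -> glued w k ->
  glued (a *: v + w) (a *: i + k).
Proof.
move=> gv gw x.
have [U [h [dU [u [f [Ux ev ei]]]]]] := gv x.
have [V [h' [dV [u' [f' [Vx ew ek]]]]]] := gw x.
pose W := opensI U V; have dW : dense W by apply: irr; exists x.
have hW : W `<=` opensT X by [].
exists W, hW, dW, (a *: res (opensIl U V) u + res (opensIr U V) u'), (a *: f + f').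
split=> //.
  rewrite -ratD -ratZ !rat_res linearP ev ew scalerDr !addrA; congr (_ + _).
  by rewrite addrAC.
rewrite linearP.
rewrite -(res_res h (opensIl U V) hW) -(res_res h' (opensIr U V) hW) ei ek.
rewrite !linearD /= -!shom_res.
by rewrite addrACA !linearZ.
Qed.

Let glued_ex w : smem (second_kind Om) w -> exists2 i, smem (cocycles I 1) i & glued w i.
Proof.
move=> /skP lw.
pose R V (s : I 1%N V) := exists (dV : dense V) (u : Om V) f,
  w = rat dV u + rat_map (kd Om) f /\ s = iota1 V u + d0 V (E V f).
have [||i iP] := @sheaf_glue_rel _ _ (I 1%N) (opensT X) R.
- move=> x _; have [U [dU [u [f [Ux ew]]]]] := lw x.
  by exists U, (iota1 U u + d0 U (E U f)); split=> //; exists dU, u, f.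
- move=> V V' _ _ _ _ [dV [u [f [ew ->]]]] [dV' [u' [f' [ew' ->]]]].
  by apply: (decompE2 _ _ (opensI_dense dV dV') ew ew').
have gwi : glued w i.
  move=> x; have [U [dU [u [f [Ux ew]]]]] := lw x.
  have h : U `<=` opensT X by [].
  by exists U, h, dU, u, f; split=> //; apply: iP; exists dU, u, f.
exists i => //; rewrite /= ; apply: sheaf_eq => x _.
have [U [h [dU [u [f [Ux ew ei]]]]]] := gwi x.
exists U, h; split=> //; rewrite -shom_res ei linearD linear0 /=.
(* The de Rham differential is 0 in degree 1, so iota1 u is closed; [cx_dd] takes care of the term d
   (E f). *)
have := @chom_d _ _ _ _ (ir_map I) 1%N U u; rewrite -/iota1 => <-.
by rewrite cx_dd addr0 linear0.
Qed.

(** Conversely, if i = dk then iota1 u = d (k - E f) on U, and injectivity on the first cohomology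
    sheaf gives u = dt near x. One point suffices, since w is determined on any nonempty open
    set. *)
Let glued_exact w i : smem (second_kind Om) w -> smem (cocycles I 1) i ->
  glued w i -> smem (exact_forms Om) w <-> smem (coboundaries I 1) i.
Proof.
move=> _ _ gwi; split=> [[f ew]|[k ei]].
  exists (E (opensT X) f).
  have h : opensT X `<=` opensT X by [].
  rewrite -[LHS](res_id h).
  rewrite (gluedE gwi h (u := 0) (dU := @opensT_dense X) (f := f)).
    by rewrite linear0 add0r.
  by rewrite -rat0 add0r.
case: X0 => x _; have [U [h [dU [u [f [Ux ew eiU]]]]]] := gwi x.
have [qi _] := ir_qis I.
have [||V [k' [Vx [t et]]]] := qi 1%N U u _ _ x Ux.
- by [].
- move=> y Uy; exists U, (@subset_refl _ _); split=> //.
  rewrite res_id; exists (res h k - E U f); rewrite linearB /=.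
  by rewrite shom_res -ei eiU addrK.
have dV : dense V by apply: irr; exists x.
exists (rat dV t + f); rewrite linearD /= rat_mapE ew; congr (_ + _).
by rewrite -(rat_res dU dV k') et.
Qed.

(** * Local presentations of a cocycle, and surjectivity *)

Let loc_rel (i : I 1%N (opensT X)) U (w : Om U) (k : I 0%N U) :=
  forall h : U `<=` opensT X, res h i = iota1 U w + d0 U k.

(** Compares two presentations iota w + dk = iota w' + dk' of one cocycle through a regular function
    g. It is vacuous unless W lies in U and V, hence the inclusions assumed below. *)
Let diff_rel U V (w : Om U) (k : I 0%N U) (w' : Om V) (k' : I 0%N V) W (g : O W) :=
  forall (h : W `<=` U) (h' : W `<=` V),
    iota0 W g = res h k - res h' k' /\ kd Om W g = res h' w' - res h w.

(** In degree 0 the only boundary is 0, so injectivity on the cohomology sheaf is injectivity on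
    closed functions. *)
Let iota0_inj U (g : O U) : iota0 U g = 0 -> kd Om U g = 0 -> g = 0.
Proof.
move=> g0 dg0; apply: sheaf_eq => x Ux; have [qi _] := ir_qis I.
have [|V [h [Vx eg]]] := qi 0%N U g dg0 _ x Ux; last by exists V, h; rewrite linear0.
by move=> y Uy; exists U, (@subset_refl _ _); split=> //; rewrite res_id.
Qed.

Let diff_uniq U V (w : Om U) (k : I 0%N U) (w' : Om V) (k' : I 0%N V) W (g g' : O W) :
  W `<=` U -> W `<=` V ->
  diff_rel w k w' k' g -> diff_rel w k w' k' g' -> g = g'.
Proof.
move=> h h' /(_ h h')[i1 k1] /(_ h h')[i2 k2].
apply/eqP; rewrite -subr_eq0; apply/eqP; apply: iota0_inj.
  by rewrite linearB /= i1 i2 subrr.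
by rewrite linearB /= k1 k2 subrr.
Qed.

Let diff_res U V (w : Om U) (k : I 0%N U) (w' : Om V) (k' : I 0%N V) W W' (g : O W)
  (l : W' `<=` W) : W `<=` U -> W `<=` V ->
  diff_rel w k w' k' g -> diff_rel w k w' k' (res l g).
Proof.
move=> m m' /(_ m m') [i1 k1] h h'.
by rewrite !shom_res i1 k1 !linearB /= !(res_res _ _ h) !(res_res _ _ h').
Qed.

(** Acyclicity of the cone of iota. As iota1 w1 = d k1, injectivity on the first cohomology sheaf
    gives w1 = dt locally; k1 - iota0 t is then closed, and surjectivity in degree 0 makes it
    locally iota0 s with ds = 0. Take g = t + s; its uniqueness permits gluing. *)
Let diff_ex i U V (w : Om U) (k : I 0%N U) (w' : Om V) (k' : I 0%N V) :
  loc_rel i w k -> loc_rel i w' k' ->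
  exists g : O (opensI U V), diff_rel w k w' k' g.
Proof.
move=> iU iV; set N := opensI U V.
pose w1 := res (opensIr U V) w' - res (opensIl U V) w.
pose k1 := res (opensIl U V) k - res (opensIr U V) k'.
have eN : iota1 N w1 = d0 N k1.
  rewrite !linearB /= !shom_res; apply: (proj1 (addr_cross _ _ _ _)).
  have hN : N `<=` opensT X by [].
  have hU : U `<=` opensT X by [].
  have hV : V `<=` opensT X by [].
  transitivity (res hN i).
    by rewrite -(res_res hV (opensIr U V) hN) (iV hV) linearD.
  by rewrite -(res_res hU (opensIl U V) hN) (iU hU) linearD.
have [qi qs] := ir_qis I.
have lex x : oset N x -> exists W (g : O W), [/\ W `<=` N, oset W x & diff_rel w k w' k' g].
  move=> Nx.
  have [||W [h [Wx [t et]]]] := qi 1%N N w1 _ _ x Nx.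
  - by [].
  - move=> y Ny; exists N, (@subset_refl _ _); split=> //.
    by rewrite res_id; exists k1.
  have dt : d0 W (res h k1 - iota0 W t) = 0.
    by rewrite linearB /= shom_res -eN -iotad -et -shom_res subrr.
  have [W' [h' [s [W'x ds es]]]] := qs 0%N W _ dt x Wx.
  have W'N : W' `<=` N by move=> y /h' /h.
  exists W', (res h' t + s); split=> // l l'.
  have e1 : iota0 W' (res h' t + s) = res W'N k1.
    move: es; rewrite /= linearB /= -shom_res (res_res _ _ W'N) => /eqP.
    by rewrite -addrA -opprD subr_eq0 => /eqP ->; rewrite linearD.
  have e2 : kd Om W' (res h' t + s) = res W'N w1.
    rewrite linearD shom_res /=; move: et; rewrite /= => <-.
    by rewrite (res_res _ _ W'N) [X in _ + X]ds addr0.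
  by rewrite e1 e2 !linearB /= !(res_res _ _ l) !(res_res _ _ l').
have [||g gP] := @sheaf_glue_rel _ _ O N (fun W g => diff_rel w k w' k' g).
- exact: lex.
- move=> W W' g g' hW hW' dg dg'.
  have hU : opensI W W' `<=` U by move=> y [/hW []].
  have hV : opensI W W' `<=` V by move=> y [/hW []].
  apply: (diff_uniq hU hV).
    by apply: diff_res => // y /hW [].
  by apply: diff_res => // y /hW' [].
exists g => h h'.
split; apply: sheaf_eq => x Nx; have [W [g' [hW Wx dg']]] := lex x Nx.
  exists W, hW; split=> //; rewrite -shom_res (gP W hW g' dg').
  have hU : W `<=` U by move=> y /hW [].
  have hV : W `<=` V by move=> y /hW [].
  have [-> _] := dg' hU hV.
  by rewrite linearB /= !(res_res _ _ hU) !(res_res _ _ hV).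
exists W, hW; split=> //; rewrite -shom_res (gP W hW g' dg').
have hU : W `<=` U by move=> y /hW [].
have hV : W `<=` V by move=> y /hW [].
have [_ ->] := dg' hU hV.
by rewrite linearB /= !(res_res _ _ hU) !(res_res _ _ hV).
Qed.

Let loc_ex i : smem (cocycles I 1) i -> forall x : X, exists U (w : Om U) (k : I 0%N U),
  oset U x /\ loc_rel i w k.
Proof.
move=> di x; have [_ qs] := ir_qis I.
have [U [h [w [Ux _ [k ek]]]]] := qs 1%N (opensT X) i di x (Logic.I).
exists U, w, k; split=> // h'.
by rewrite (Prop_irrelevance h' h) addrC; apply/eqP; rewrite -subr_eq; apply/eqP.
Qed.

Let glued_surj i : smem (cocycles I 1) i -> exists w i',
  [/\ smem (second_kind Om) w, smem (cocycles I 1) i', glued w i'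
    & smem (coboundaries I 1) (i - i')].
Proof.
move=> di; case: X0 => x0 _; have [U0 [w0 [k0 [Ux0 l0]]]] := loc_ex di x0.
have dU0 : dense U0 by apply: irr; exists x0.
(* One presentation serves as reference. Any nonempty U meets U0 in a dense set, so the g comparing
   U with U0 is a rational function; these g split in K(X) the cocycle of differences, and w = u +
   dg on U. *)
pose w := rat dU0 w0.
have dec U (dU : dense U) (u : Om U) k (g : O (opensI U U0)) :
    diff_rel u k w0 k0 g ->
    w = rat dU u + rat_map (kd Om) (rat (opensI_dense dU dU0) g).
  move=> /(_ (opensIl U U0) (opensIr U U0))[_ eg].
  rewrite rat_mapE eg linearB /= !rat_res.
  by rewrite addrC subrK.
have sw : smem (second_kind Om) w.
  apply/skP => x; have [U [u [k [Ux lu]]]] := loc_ex di x.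
  have dU : dense U by apply: irr; exists x.
  have [g gP] := diff_ex lu l0.
  by exists U, dU, u, (rat (opensI_dense dU dU0) g); split=> //; exact: dec gP.
have [i' di' gwi] := glued_ex sw; exists w, i'; split=> //.
(* On overlaps k - k' = iota0 g2 while g - g' = g2, so the sections k - E g glue; the differential
   of the result is i - i'. *)
pose R V (s : I 0%N V) := exists (dV : dense V) (u : Om V) (k : I 0%N V)
  (g : O (opensI V U0)), [/\ loc_rel i u k, diff_rel u k w0 k0 g
    & s = k - E V (rat (opensI_dense dV dU0) g)].
have Rex x : oset (opensT X) x -> exists V (s : I 0%N V),
    [/\ V `<=` opensT X, oset V x & R V s].
  move=> _; have [U [u [k [Ux lu]]]] := loc_ex di x.
  have dU : dense U by apply: irr; exists x.
  have [g gP] := diff_ex lu l0.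
  exists U, (k - E U (rat (opensI_dense dU dU0) g)); split=> //.
  by exists dU, u, k, g.
have [//||k kP] := @sheaf_glue_rel _ _ (I 0%N) (opensT X) R.
  move=> V V' _ _ _ _ [dV [u [k [g [lu gP ->]]]]] [dV' [u' [k' [g' [lu' gP' ->]]]]].
  have [g2 g2P] := diff_ex lu lu'.
  pose N := opensI V V'; have dN : dense N := opensI_dense dV dV'.
  pose M := opensI N U0; have dM : dense M := opensI_dense dN dU0.
  have hg : M `<=` opensI V U0 by move=> y [[]].
  have hg' : M `<=` opensI V' U0 by move=> y [[]].
  have hg2 : M `<=` N by move=> y [].
  have eg : res hg g - res hg' g' = res hg2 g2.
    have m : M `<=` V by move=> y [[]].
    have m' : M `<=` V' by move=> y [[]].
    have m0 : M `<=` U0 by move=> y [].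
    apply: (diff_uniq m m'); last by apply: diff_res g2P => y [].
    move=> l l'; have [a1 b1] := gP (opensIl _ _) (opensIr _ _).
    have [a2 b2] := gP' (opensIl _ _) (opensIr _ _).
    rewrite !linearB /= !shom_res a1 b1 a2 b2 !linearB /=.
    rewrite !(res_res _ _ m0) !(res_res _ _ l) !(res_res _ _ l'); split.
      by rewrite opprK addrACA addNr addr0.
    by rewrite opprK addrACA subrr add0r addrC.
  have [e2 _] := g2P (opensIl V V') (opensIr V V').
  rewrite !linearB /= !E_res; apply: (proj2 (addr_cross _ _ _ _)).
  rewrite -e2 opprK addrC -[E _ _ - E _ _]linearB /= -(E_rat dN) -/N; congr (E N _).
  rewrite -(rat_res dN dM hg2) -eg linearB /= !rat_res.
  - exact: opensI_dense.
  - exact: opensI_dense.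
  - move=> d1 d2; congr (rat _ g - rat _ g'); exact: Prop_irrelevance.
exists k; apply: sheaf_eq => x _.
have [V [s [hV Vx [dV [u [l [g [lu gP es]]]]]]]] := Rex x Logic.I.
exists V, hV; split=> //.
rewrite linearB /= -shom_res (kP V hV s); last by exists dV, u, l, g.
rewrite lu (gluedE gwi hV (dec _ _ _ _ _ gP)) es linearB /=.
by rewrite opprD addrACA subrr add0r.
Qed.

Lemma second_kind_hypercohomology_ext :
  exists phi : {linear subquot (second_kind Om) (exact_forms Om) ->
                       hypercohomology I 1%N},
    bijective phi.
Proof.
apply: (subquot_rel_iso (P := glued)).
- by move=> a u v u' v'; exact: glued_linear.
- exact: glued_ex.
- exact: glued_surj.
- exact: glued_exact.
Qed.
End Extension.

Lemma second_kind_hypercohomology :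
  exists phi : {linear subquot (second_kind Om) (exact_forms Om) ->
                       hypercohomology I 1%N},
    bijective phi.
Proof.
have [e ej] := @ir_inj _ _ _ I 0%N O B j iota0 jinj.
exact: (second_kind_hypercohomology_ext ej).
Qed.
End Main.

(** * Differentials *)

Section RegularFunctions.
Variables (K : closedFieldType) (X : prevariety K).
Implicit Types (U V W : opens X) (x y : X) (f g : X -> K).

(* Junk value: 0 if f is not regular on V. *)
Definition rf V f : regfun V :=
  if pselect (regular V f) is left r then regfun_mk r else 0.

Lemma rfE V f y : regular V f -> oset V y -> rfun (rf V f) y = f y.
Proof. by move=> r Vy; rewrite /rf; case: pselect => // r'; rewrite regfun_mkE. Qed.

Lemma rf_rfun V (f : regfun V) : rf V (rfun f) = f.
Proof. by apply: regfun_eq => y Vy; rewrite rfE //; case: (regfunP f). Qed.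

Lemma res_rf V W (h : W `<=` V) f : regular V f -> regfun_res h (rf V f) = rf W f.
Proof.
move=> r; apply: regfun_eq => y Wy; rewrite regfun_resE // !rfE //.
  exact: regular_res r.
exact: h.
Qed.

Lemma rf_eq V f g : regular V f -> (forall y, oset V y -> f y = g y) -> rf V f = rf V g.
Proof.
move=> r fg; have r' := regular_ext fg r.
by apply: regfun_eq => y Vy; rewrite !rfE // fg.
Qed.

Lemma rfD V f g : regular V f -> regular V g ->
  rf V (fun y => f y + g y) = rf V f + rf V g.
Proof.
by move=> r r'; apply: regfun_eq => y Vy; rewrite rfunD !rfE //; exact: regularD.
Qed.

Lemma rfM V f g : regular V f -> regular V g ->
  rf V (fun y => f y * g y) = rf V f * rf V g.
Proof.
by move=> r r'; apply: regfun_eq => y Vy; rewrite regfun_mulE !rfE //; exact: regularM.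
Qed.

Lemma rf_cst V (c : K) : rf V (fun=> c) = c *: (1 : regfun V).
Proof.
apply: regfun_eq => y Vy; rewrite rfE //; last exact: regular_cst.
by rewrite rfunZ regfun_mkE // mulr1.
Qed.

Lemma rfun1 V y : oset V y -> rfun (1 : regfun V) y = 1.
Proof. by move=> Vy; rewrite regfun_mkE. Qed.

Lemma rfunM V (f g : regfun V) y : rfun (f * g) y = rfun f y * rfun g y.
Proof. exact: regfun_mulE. Qed.

Lemma rfunB V (f g : regfun V) y : rfun (f - g) y = rfun f y - rfun g y.
Proof. by rewrite -scaleN1r rfunD rfunZ mulN1r. Qed.

Lemma regular_inv U f : regular U f -> (forall y, oset U y -> f y != 0) ->
  regular U (fun y => (f y)^-1).
Proof.
move=> /regularP rf fn0; apply/regularP => y Uy.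
by apply: regular_atV; [exact: rf|exact: fn0].
Qed.

Lemma regularX U f k : regular U f -> regular U (fun y => f y ^+ k).
Proof. by move=> /regularP rf; apply/regularP => y Uy; exact/regular_atX/rf. Qed.

Lemma regularB U f g : regular U f -> regular U g -> regular U (fun y => f y - g y).
Proof.
move=> /regularP rf /regularP rg; apply/regularP => y Uy.
by apply: regular_atB; [exact: rf|exact: rg].
Qed.
End RegularFunctions.

Section Differentials.
Variables (K : closedFieldType) (X : prevariety K) (Om : kahler X).
Implicit Types (U V W : opens X) (x y : X) (f g : X -> K).

(** A copy of [Om V] whose scalars are the functions on V, beside the K-module structure that [Om V]
    has from the sheaf. *)
Definition forms V : Type := Om V.
HB.instance Definition _ V := GRing.Zmodule.on (forms V).

Fact forms_scale1 V : left_id (1 : regfun V) (@kact K X Om V).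
Proof. by move=> w; rewrite -[1 in LHS]scale1r kact_cst scale1r. Qed.

HB.instance Definition _ V := GRing.Zmodule_isLmodule.Build (regfun V) (forms V)
  (fun a b w => esym (kactM (k := Om) a b w)) (@forms_scale1 V) (@kactDr K X Om V)
  (fun w a b => kactDl (k := Om) a b w).

Definition dif V (f : regfun V) : forms V := kd Om V f.

Definition resf U V (h : V `<=` U) (w : forms U) : forms V := res (s := Om) h w.

Lemma resfD U V (h : V `<=` U) (v w : forms U) : resf h (v + w) = resf h v + resf h w.
Proof. exact: linearD. Qed.

Lemma resf0 U V (h : V `<=` U) : resf h 0 = 0.
Proof. exact: linear0. Qed.

HB.instance Definition _ U V (h : V `<=` U) :=
  GRing.isNmodMorphism.Build (forms U) (forms V) (resf h) (resf0 h, resfD h).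

Lemma resfZ U V (h : V `<=` U) (f : regfun U) (w : forms U) :
  resf h (f *: w) = regfun_res h f *: resf h w.
Proof. exact: kact_res. Qed.

Lemma resf_dif U V (h : V `<=` U) (f : regfun U) :
  resf h (dif f) = dif (regfun_res h f).
Proof. by rewrite /resf /dif -shom_res. Qed.

Lemma resf_resf U V W (h : V `<=` U) (k : W `<=` V) (l : W `<=` U) (w : forms U) :
  resf k (resf h w) = resf l w.
Proof. exact: res_res. Qed.

Lemma difD V (f g : regfun V) : dif (f + g) = dif f + dif g.
Proof. exact: linearD. Qed.

Lemma difM V (f g : regfun V) : dif (f * g) = f *: dif g + g *: dif f.
Proof. exact: kdM. Qed.

Lemma dif1 V : dif (1 : regfun V) = 0.
Proof.
have := difM (1 : regfun V) 1; rewrite mulr1 !scale1r => /esym/eqP.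
by rewrite -subr_eq0 addrK => /eqP.
Qed.

Lemma dif_cst V (c : K) : dif (rf V (fun=> c)) = 0.
Proof. by rewrite rf_cst /dif linearZ /= -/(dif _) dif1 scaler0. Qed.

Lemma difX V (f : regfun V) k : dif (f ^+ k.+1) = (f ^+ k *+ k.+1) *: dif f.
Proof.
elim: k => [|k IH]; first by rewrite expr1 expr0 mulr1n scale1r.
rewrite exprS difM IH scalerA -scalerDl; congr (_ *: _).
by rewrite mulrnAr -exprS addrC -mulrS.
Qed.

Definition generated_forms V : submodule (forms V).
Proof.
exists [set s | exists n (a f : 'I_n -> regfun V), s = \sum_i a i *: dif (f i)].
- by exists 0%N, (fun=> 0), (fun=> 0); rewrite big_ord0.
- move=> _ _ [n [a [f ->]]] [m [b [g ->]]].
  pose c (T : Type) (p : 'I_n -> T) (q : 'I_m -> T) (i : 'I_(n + m)) :=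
    match fintype.split i with inl j => p j | inr j => q j end.
  exists (n + m)%N, (c _ a b), (c _ f g); rewrite big_split_ord /=.
  congr (_ + _); apply: eq_bigr => i _; rewrite /c.
    by rewrite -[lshift m i]/(unsplit (inl i)) unsplitK.
  by rewrite -[rshift n i]/(unsplit (inr i)) unsplitK.
- move=> b _ [n [a [f ->]]]; exists n, (fun i => b * a i), f.
  by rewrite scaler_sumr; apply: eq_bigr => i _; rewrite scalerA.
Defined.

(* The projection to the quotient by the span of the df and 0 are both
   factorizations of the derivation 0, so they agree. *)
Lemma affine_forms_generated V (s : forms V) : affine V ->
  exists n (a f : 'I_n -> regfun V), s = \sum_i a i *: dif (f i).
Proof.
move=> aff; pose M := quotmod (generated_forms V).
have der0 : derivation (fun _ : regfun V => 0 : M).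
  by split=> *; rewrite ?addr0 ?scaler0 ?addr0.
have [phi [_ phiU]] := @kahler_univ _ _ Om V aff M _ der0.
apply/(@quotmod_pi0 _ _ (generated_forms V) s).
have <- := phiU (\pi_M : Om V -> M).
  by have -> := phiU (fun=> 0); [|split=> // *; rewrite ?addr0 ?scaler0].
split.
- by move=> v w; rewrite -quotmod_piD.
- by move=> f w; rewrite -quotmod_scale_pi.
- move=> f; apply/quotmod_pi0; exists 1%N, (fun=> 1), (fun=> f).
  by rewrite big_ord1 scale1r.
Qed.

Section Evaluation.
Variables (V : opens X) (y : X) (Vy : oset V y).

(** K as a module over the functions on V by evaluation at y. The [let] records V and y in the type,
    so that this structure can be inferred. *)
Definition residue_field : Type := let _ := Vy in K.
HB.instance Definition _ := GRing.Zmodule.on residue_field.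

Definition residue_scale (a : regfun V) (c : residue_field) : residue_field :=
  rfun a y * c.

Fact residue_scaleA a b c : residue_scale a (residue_scale b c) = residue_scale (a * b) c.
Proof. by rewrite /residue_scale rfunM mulrA. Qed.

Fact residue_scale1 : left_id 1 residue_scale.
Proof. by move=> c; rewrite /residue_scale rfun1 // mul1r. Qed.

Fact residue_scaleDr : right_distributive residue_scale +%R.
Proof. by move=> a c d; rewrite /residue_scale mulrDr. Qed.

Fact residue_scaleDl c : {morph residue_scale^~ c : a b / a + b}.
Proof. by move=> a b; rewrite /residue_scale rfunD mulrDl. Qed.

HB.instance Definition _ := GRing.Zmodule_isLmodule.Build (regfun V) residue_field
  residue_scaleA residue_scale1 residue_scaleDr residue_scaleDl.
End Evaluation.

(** c is the value of df/dt at y. *)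
Definition lp_coef y t f (c : K) := exists u,
  [/\ regular_at y u, u y = c & \forall z \near y, f z - f y = u z * t z].

Lemma lp_coef_ex y t f : local_parameter y t -> regular_at y f -> exists c, lp_coef y t f c.
Proof.
move=> lp rf.
have [|u ru fE] := @lp_divide _ _ y t lp (fun z => f z - f y).
  by split; [apply: regular_atB => //; exact: regular_at_cst|rewrite subrr].
by exists (u y), u.
Qed.

Lemma lp_coef_uniq y t f c d :
  local_parameter y t -> lp_coef y t f c -> lp_coef y t f d -> c = d.
Proof.
move=> lp [u [ru <- uE]] [v [rv <- vE]]; apply/eqP; rewrite -subr_eq0; apply/eqP.
have := lp_nonzerodivisor lp (regular_atB ru rv).
move=> /(_ _)/nbhs_singleton; apply.
by apply: filterS2 uE vE => z uE vE; rewrite mulrBl -uE -vE subrr.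
Qed.

(* The derivation f |-> u y, where f - f y = u t near y, takes the value 1 at t. *)
Lemma dif_lp_neq0 y t V : local_parameter y t -> oset V y -> regular V t ->
  dif (rf V t) <> 0.
Proof.
move=> lp Vy rt dt0; have [V' [aff V'V V'y]] := affine_basis Vy.
have rg (f : regfun V') : regular_at y (rfun f).
  by exists V'; split=> //; case: (regfunP f).
have [D DP] := choice (fun f : regfun V' => lp_coef_ex lp (rg f)).
pose M := residue_field V'y.
have derD : derivation (D : regfun V' -> M).
  split=> [a b|a b|c].
  - apply: (lp_coef_uniq lp (DP (a + b))).
    have [u [ru <- uE]] := DP a; have [v [rv <- vE]] := DP b.
    exists (fun z => u z + v z); split=> //; first exact: regular_atD.
    by apply: filterS2 uE vE => z uE vE; rewrite !rfunD mulrDl -uE -vE; ring.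
  - apply: (lp_coef_uniq lp (DP (a * b))).
    have [u [ru <- uE]] := DP a; have [v [rv <- vE]] := DP b.
    exists (fun z => rfun a z * v z + rfun b y * u z); split=> //.
      by apply: regular_atD; [exact: regular_atM|exact: regular_atZ].
    apply: filterS2 uE vE => z uE vE; rewrite !rfunM.
    by rewrite mulrDl -mulrA -vE -mulrA -uE; ring.
  - apply: (lp_coef_uniq lp (DP _)); exists (fun=> 0); split=> //.
      exact: regular_at_cst.
    apply: filterS (opens_near V'y) => z V'z.
    by rewrite !rfunZ !rfun1 // mul0r subrr.
have [phi [[phiD phiM phid] _]] := @kahler_univ _ _ Om V' aff M _ derD.
have phi0 : phi 0 = 0.
  by have := phiD 0 0; rewrite addr0 => /esym/eqP; rewrite -subr_eq0 addrK => /eqP.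
have D1 : D (rf V' t) = 1.
  apply: (lp_coef_uniq lp (DP _)); exists (fun=> 1); split=> //.
    exact: regular_at_cst.
  have rt' := regular_res V'V rt.
  apply: filterS (opens_near V'y) => z V'z.
  by rewrite !rfE // (lp_0 lp) subr0 mul1r.
have : dif (rf V' t) = 0 by rewrite -(res_rf V'V rt) -resf_dif dt0 raddf0.
rewrite /dif => dt0'; move: D1; rewrite -phid dt0' phi0 => /eqP.
by rewrite eq_sym oner_eq0.
Qed.
End Differentials.

(** * Omega^1 near a point: generation by dt, and freeness *)

Section Spanning.
Variables (K : closedFieldType) (X : prevariety K) (Om : kahler X).
Implicit Types (U V W : opens X) (x y : X).

Local Notation forms := (forms Om).
Local Notation dif := (dif Om).

(** Membership of the germ of s in the submodule of the stalk at x generated by the d (b i). *)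
Definition spanned x m (b : 'I_m -> X -> K) U (s : forms U) :=
  exists V (h : V `<=` U) (c : 'I_m -> X -> K),
    [/\ oset V x, forall i, regular V (b i), forall i, regular V (c i)
      & resf h s = \sum_i rf V (c i) *: dif (rf V (b i))].

Section Span.
Variables (x : X) (m : nat) (b : 'I_m -> X -> K).

Lemma res_comb V W (h : W `<=` V) (c : 'I_m -> X -> K) :
  (forall i, regular V (b i)) -> (forall i, regular V (c i)) ->
  resf h (\sum_i rf V (c i) *: dif (rf V (b i))) =
  \sum_i rf W (c i) *: dif (rf W (b i)).
Proof.
move=> rb rc; rewrite raddf_sum; apply: eq_bigr => i _.
by rewrite /= resfZ resf_dif !res_rf.
Qed.

Lemma spanned_res U V (h : V `<=` U) (s : forms U) : oset V x ->
  spanned x b (resf h s) <-> spanned x b s.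
Proof.
move=> Vx; split=> [[W [k [c [Wx rb rc e]]]]|[W [k [c [Wx rb rc e]]]]].
  exists W, (subset_trans k h), c; split=> //.
  by rewrite -e (resf_resf h k (subset_trans k h)).
exists (opensI V W), (opensIl V W), c; split=> //.
- by move=> i; apply: regular_res (rb i); exact: opensIr.
- by move=> i; apply: regular_res (rc i); exact: opensIr.
have l : opensI V W `<=` U := subset_trans (opensIl V W) h.
rewrite (resf_resf h _ l) -(res_comb (opensIr V W) rb rc) -e.
by rewrite (resf_resf k _ l).
Qed.

Lemma spanned0 U : oset U x -> (forall i, regular_at x (b i)) -> spanned x b (0 : forms U).
Proof.
move=> Ux rb.
have /near_opens[W [Wx WP]] : \forall y \near x, forall i, exists V, oset V y /\ regular V (b i).
  apply: filter_forall => i; have [V [Vx rV]] := rb i.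
  by apply: filterS (opens_near Vx) => y Vy; exists V.
exists (opensI U W), (opensIl U W), (fun=> fun=> 0); split=> //.
- move=> i; apply/regularP => y [_ /WP/(_ i)[V [Vy rV]]].
  by exists V.
- by move=> i; exact: regular_cst.
- rewrite raddf0 big1 // => i _; rewrite rf_cst.
  by rewrite scale0r scale0r.
Qed.

Lemma spannedD U (s s' : forms U) :
  spanned x b s -> spanned x b s' -> spanned x b (s + s').
Proof.
move=> [V [k [c [Vx rb rc e]]]] [V' [k' [c' [V'x rb' rc' e']]]].
pose W := opensI V V'; have rcW i := regular_res (opensIl V V') (rc i).
have rcW' i := regular_res (opensIr V V') (rc' i).
have l : W `<=` U := subset_trans (opensIl V V') k.
exists W, l, (fun i y => c i y + c' i y).
split=> //.
- by move=> i; apply: regular_res (rb i); exact: opensIl.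
- by move=> i; exact: regularD.
rewrite raddfD /= -(resf_resf k (opensIl V V') l) -(resf_resf k' (opensIr V V') l).
rewrite e e' !res_comb // -big_split; apply: eq_bigr => i _.
by rewrite rfD // scalerDl.
Qed.

Lemma spannedZ U (a : regfun U) (s : forms U) :
  spanned x b s -> spanned x b (a *: s).
Proof.
move=> [V [k [c [Vx rb rc e]]]]; have ra := regular_res k (regfunP a).1.
exists V, k, (fun i y => rfun a y * c i y); split=> //.
  by move=> i; exact: regularM.
rewrite resfZ e scaler_sumr; apply: eq_bigr => i _.
rewrite scalerA rfM //; congr (_ * _ *: _).
by apply: regfun_eq => y Vy; rewrite rfE // regfun_resE.
Qed.

Lemma spanned_sum U n (F : 'I_n -> forms U) :
  oset U x -> (forall i, regular_at x (b i)) ->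
  (forall i, spanned x b (F i)) -> spanned x b (\sum_i F i).
Proof.
move=> Ux rb bF; elim/big_ind: _ => //; first exact: spanned0.
exact: spannedD.
Qed.
End Span.

Lemma spanned_trans x m n (b : 'I_m -> X -> K) (b' : 'I_n -> X -> K) U (s : forms U) :
  (forall i, regular_at x (b i)) ->
  (forall i V, oset V x -> regular V (b' i) -> spanned x b (dif (rf V (b' i)))) ->
  spanned x b' s -> spanned x b s.
Proof.
move=> rb bb [V [h [c [Vx rb' rc e]]]]; apply/(spanned_res _ h) => //; rewrite e.
by apply: spanned_sum => // i; apply/spannedZ/bb.
Qed.

Section Coordinates.
Variables (U0 : opens X) (n : nat) (phi : X -> 'I_n -> K).
Hypothesis ch : chart U0 phi.

Let coord (i : 'I_n) (y : X) : K := phi y i.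

Lemma coord_regular U i : U `<=` U0 -> regular U (coord i).
Proof.
move=> UU0; apply/regularP => y /UU0 Uy.
apply: regular_at_eq (chart_poly ch (mpolyX K (mnm1 i)) Uy).
by apply: nearW => z; rewrite mevalXU.
Qed.

Lemma poly_regular U p : U `<=` U0 -> regular U (fun y => meval (phi y) p).
Proof. by move=> UU0; apply/regularP => y /UU0 Uy; exact: chart_poly ch _ _ _. Qed.

Lemma dif_poly_spanned x U p : oset U x -> U `<=` U0 ->
  spanned x coord (dif (rf U (fun y => meval (phi y) p))).
Proof.
move=> Ux UU0; have rp q := poly_regular q UU0.
have rc i : regular_at x (coord i) by exists U; split=> //; exact: coord_regular.
elim/mpoly_alg_ind: p => [c|i|p q hp hq|p q hp hq].
- rewrite (rf_eq (g := fun=> c)) //; last by move=> y _; rewrite mevalC.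
  by rewrite dif_cst; exact: spanned0.
- exists U, (@subset_refl _ _), (fun j => fun=> (j == i)%:R); split=> //.
  + by move=> j; exact: coord_regular.
  + by move=> j; exact: regular_cst.
  rewrite /resf res_id (bigD1 i) //= eqxx big1 ?addr0.
    rewrite rf_cst scale1r scale1r; congr dif; apply: rf_eq => // y _.
    by rewrite mevalXU.
  by move=> j /negbTE ->; rewrite rf_cst scale0r scale0r.
- rewrite (rf_eq (g := fun y => meval (phi y) p + meval (phi y) q)) //; last first.
    by move=> y _; rewrite mevalD.
  by rewrite rfD // difD; exact: spannedD.
- rewrite (rf_eq (g := fun y => meval (phi y) p * meval (phi y) q)) //; last first.
    by move=> y _; rewrite mevalM.
  by rewrite rfM // difM; apply: spannedD; exact: spannedZ.
Qed.

Lemma dif_spanned x U (f : regfun U) : oset U x -> oset U0 x -> spanned x coord (dif f).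
Proof.
move=> Ux U0x; have rf_ : regular_at x (rfun f).
  by exists U; split=> //; case: (regfunP f).
have /(chart_frac ch _ U0x)[p [q /near_opens[N [Nx NE]]]] := rf_.
pose W := opensI U (opensI U0 N).
have WU : W `<=` U by move=> y [].
have WU0 : W `<=` U0 by move=> y [_ []].
have Wx : oset W x by [].
have qn0 y : oset W y -> meval (phi y) q != 0 by case=> _ [_ /NE[]].
have rp := poly_regular p WU0; have rq := poly_regular q WU0.
have rq' := regular_inv rq qn0.
apply/(spanned_res _ WU) => //; rewrite resf_dif.
set F := regfun_res WU f.
set P := rf W (fun y => meval (phi y) p); set Q := rf W (fun y => meval (phi y) q).
have FQ : F * Q = P.
  apply: regfun_eq => y Wy; rewrite rfunM regfun_resE // !rfE //.
  by have [_ [_ /NE[qy ->]]] := Wy; rewrite divfK.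
pose Q' := rf W (fun y => (meval (phi y) q)^-1).
have Q'Q : Q' * Q = 1.
  apply: regfun_eq => y Wy; rewrite rfunM !rfE // rfun1 // mulVf //; exact: qn0.
(* The quotient rule, obtained by differentiating F Q = P. *)
have -> : dif F = Q' *: (dif P + (- F) *: dif Q).
  rewrite -FQ difM addrAC -scalerDl subrr scale0r add0r scalerA Q'Q.
  by rewrite scale1r.
by apply/spannedZ/spannedD; [|apply: spannedZ]; exact: dif_poly_spanned.
Qed.

Lemma form_spanned_coord x U (s : forms U) : oset U x -> oset U0 x -> spanned x coord s.
Proof.
move=> Ux U0x; have [V [aff VU Vx]] := affine_basis Ux.
apply/(spanned_res _ VU) => //.
have [m [a [f ->]]] := affine_forms_generated (resf VU s) aff.
apply: spanned_sum => // [i|i].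
  by exists U0; split=> //; exact: coord_regular.
by apply: spannedZ; exact: dif_spanned.
Qed.

(* Nakayama's lemma again: the d phi_i satisfy (1 - t C) w = u dt. *)
Lemma dif_coord_lp x t U k : local_parameter x t -> oset U x -> U `<=` U0 ->
  spanned x (fun _ : 'I_1 => t) (dif (rf U (coord k))).
Proof.
move=> lp Ux UU0; have U0x := UU0 x Ux.
have ex i : exists u, regular_at x u /\ \forall y \near x, phi y i - phi x i = u y * t y.
  by have [u] := coord_lp_divide lp i ch U0x; exists u.
have [u uP] := choice ex.
have [T0 [T0x rt0]] := lp_regular lp.
have exV i : exists V, [/\ oset V x, V `<=` U, V `<=` T0, regular V (u i) &
    forall y, oset V y -> phi y i - phi x i = u i y * t y].
  have [[V [Vx rV]] /near_opens[N [Nx NE]]] := uP i.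
  exists (opensI (opensI U T0) (opensI V N)); split=> //.
  - by move=> y [[]].
  - by move=> y [[]].
  - by apply: regular_res rV => y [_ []].
  - by move=> y [_ [_ /NE]].
have [V VP] := choice exV.
have exW i : exists W (h : W `<=` V i) (c : 'I_n -> X -> K), [/\ oset W x,
    forall j, regular W (c j) &
    resf h (dif (rf (V i) (u i))) = \sum_j rf W (c j) *: dif (rf W (coord j))].
  have [Vx _ _ _ _] := VP i.
  have [W [h [c [Wx _ rc e]]]] := dif_spanned (rf (V i) (u i)) Vx U0x.
  by exists W, h, c.
have [W WP] := choice exW.
have /near_opens[N0 [N0x N0W]] : \forall y \near x, forall i, oset (W i) y.
  by apply: filter_forall => i; apply: opens_near; have [h [c []]] := WP i.
pose N := opensI (opensI U T0) N0.
have NT0 : N `<=` T0 by move=> y [[]].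
have NU0 : N `<=` U0 by move=> y [[/UU0]].
have NW i : N `<=` W i by move=> y [_ /N0W].
have NV i : N `<=` V i by have [h _] := WP i; exact: subset_trans (NW i) h.
have Nx : oset N x by [].
have rt : regular N t := regular_res NT0 rt0.
have ru i : regular N (u i) by have [_ _ _ r _] := VP i; exact: regular_res (NV i) r.
have exc i : exists c : 'I_n -> X -> K, (forall j, regular N (c j)) /\
    dif (rf N (u i)) = \sum_j rf N (c j) *: dif (rf N (coord j)).
  have [h [c [Wx rc e]]] := WP i; exists c; split.
    by move=> j; exact: regular_res (NW i) (rc j).
  have [_ VU _ ruV _] := VP i.
  have rco j : regular (W i) (coord j).
    by apply: coord_regular; apply: subset_trans UU0; exact: subset_trans VU.
  rewrite -(res_comb (NW i) rco rc) -e (resf_resf h _ (NV i)) resf_dif.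
  by rewrite (res_rf (NV i) ruV).
have [c cP] := choice exc.
pose T := rf N t; pose w i := dif (rf N (coord i)).
(* Differentiates phi_i = phi_i x + u_i t, with d u_i expanded in the d phi_j. *)
have wE i : w i = rf N (u i) *: dif T + T *: \sum_j rf N (c i j) *: w j.
  have [_ <-] := cP i; rewrite -difM -rfM // /w.
  have rco := coord_regular i NU0.
  have -> : rf N (coord i) = rf N (fun y => u i y * t y) + rf N (fun=> phi x i).
    apply: regfun_eq => y Ny; rewrite rfunD !rfE //; last exact: regularM.
      by have [_ _ _ _ <-] := VP i; [rewrite subrK|exact: NV].
    exact: regular_cst.
  by rewrite difD dif_cst addr0.
pose A : 'M[regfun N]_n := \matrix_(i, j) ((i == j)%:R - T * rf N (c i j)).
have Aw i : \sum_j A i j *: w j = rf N (u i) *: dif T.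
  under eq_bigr do rewrite mxE scalerBl.
  rewrite sumrB (bigD1 i) //= eqxx scale1r big1 ?addr0; last first.
    by move=> j ji; rewrite eq_sym (negbTE ji) scale0r.
  rewrite {1}wE scaler_sumr; under [X in _ - X]eq_bigr do rewrite -scalerA.
  by rewrite addrK.
have := cramer_module Aw k.
set D := \det A; set B := \sum_i _ => DwB.
(* Evaluation at x turns A into the identity matrix because t x = 0; so D is invertible near x. *)
have evD : rfun D x = 1.
  pose ev (a : regfun N) : K := rfun a x.
  have evB : additive ev by move=> a d; exact: rfunB.
  have evM : multiplicative ev by split=> [a d|]; [exact: rfunM|exact: rfun1].
  pose evm : {rmorphism regfun N -> K} := HB.pack ev
    (GRing.isZmodMorphism.Build (regfun N) K ev evB)
    (GRing.isMonoidMorphism.Build (regfun N) K ev (evM.2, evM.1)).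
  rewrite -[LHS]/(evm D) -det_map_mx.
  suff -> : map_mx evm A = 1%:M by rewrite det1.
  apply/matrixP => i j; rewrite !mxE rmorphB rmorph_nat rmorphM /= {1}/ev.
  by rewrite rfE // (lp_0 lp) mul0r subr0.
have [rD _] := regfunP D; pose N' := opens_nz rD.
have N'N : N' `<=` N by move=> y [].
have N'x : oset N' x by split=> //=; rewrite evD oner_neq0.
have rD' := regular_inv (regular_res N'N rD) (fun y (h : oset N' y) => h.2).
pose g := \sum_i (\adj A) k i * rf N (u i).
have Bg : B = g *: dif T.
  by rewrite scaler_suml; apply: eq_bigr => i _; rewrite scalerA.
have [rg _] := regfunP g.
have NU : N `<=` U by move=> y [[]].
have N'U := subset_trans N'N NU.
have rc0 : regular U (coord k) by exact: coord_regular.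
exists N', N'U, (fun _ y => (rfun D y)^-1 * rfun g y); split=> //.
- by move=> _; exact: regular_res N'N rt.
- by move=> _; apply: regularM => //; exact: regular_res N'N rg.
rewrite big_ord1 -(resf_resf NU N'N N'U) resf_dif (res_rf NU rc0).
have := congr1 (resf N'N) DwB; rewrite Bg !resfZ !resf_dif => e.
rewrite -(res_rf N'N rt) rfM //; last exact: regular_res N'N rg.
have -> : rf N' (rfun g) = regfun_res N'N g.
  by rewrite -(res_rf N'N) // rf_rfun.
rewrite -scalerA -e scalerA [X in _ = X *: _](_ : _ = 1) ?scale1r //.
apply: regfun_eq => y N'y; rewrite rfunM rfE // rfun1 // regfun_resE //.
by rewrite mulVf //; case: N'y.
Qed.
End Coordinates.

Lemma form_spanned_lp x t U (s : forms U) : local_parameter x t -> oset U x ->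
  spanned x (fun _ : 'I_1 => t) s.
Proof.
move=> lp Ux; have [U0 [n [phi [U0x _ ch]]]] := chart_at x.
have := form_spanned_coord ch s Ux U0x; apply: spanned_trans => [_|i V Vx rV].
  exact: lp_regular.
have VI : opensI V U0 `<=` V := opensIl V U0.
apply/(spanned_res _ VI) => //; rewrite resf_dif res_rf //.
by apply: (dif_coord_lp ch i lp _ (opensIr V U0)); split.
Qed.

Lemma form_lp x t U (s : forms U) : local_parameter x t -> oset U x ->
  exists V (h : V `<=` U) (c : X -> K), [/\ oset V x, regular V t, regular V c
    & resf h s = rf V c *: dif (rf V t)].
Proof.
move=> lp Ux; have [V [h [c [Vx rt rc e]]]] := form_spanned_lp s lp Ux.
exists V, h, (c ord0); split=> //; first exact: rt ord0.
by rewrite e big_ord1.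
Qed.

(** If a dt = 0 and a y != 0, then dt = 0 near y. Over W the differentials of the coordinates are
    multiples of dt, so every form would vanish near y, against [dif_lp_neq0] for a local parameter
    t' at y; t itself need not vanish at y. *)
Lemma dif_lp_free x t : (forall y : X, exists t', local_parameter y t') ->
  local_parameter x t ->
  exists W, [/\ oset W x, regular W t & forall N : opens X, N `<=` W ->
    forall a : regfun N, a *: dif (rf N t) = 0 -> a = 0].
Proof.
move=> lpX lp; have [U0 [n [phi [U0x _ ch]]]] := chart_at x.
pose coord (i : 'I_n) (y : X) := phi y i.
have ex i : exists V, [/\ oset V x, V `<=` U0, regular V t & exists2 c, regular V c &
    dif (rf V (coord i)) = rf V c *: dif (rf V t)].
  have [V [h [c [Vx rt rc e]]]] := form_lp (dif (rf U0 (coord i))) lp U0x.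
  exists V; split=> //; exists c => //; rewrite -e resf_dif res_rf //.
  exact: (coord_regular ch).
have [V VP] := choice ex.
have /near_opens[N0 [N0x N0V]] : \forall y \near x, forall i, oset (V i) y.
  by apply: filter_forall => i; apply: opens_near; case: (VP i).
have [T0 [T0x rt0]] := lp_regular lp.
pose W := opensI U0 (opensI T0 N0).
have WT0 : W `<=` T0 by move=> y [_ []].
have rtW := regular_res WT0 rt0.
exists W; split=> // N NW a a0; apply: regfun_eq => y Ny; rewrite rfun0.
apply: contrapT => /eqP ay; have [ra _] := regfunP a.
pose N' := opens_nz ra; have N'N : N' `<=` N by move=> z [].
have N'y : oset N' y by [].
have rt' : regular N' t := regular_res (subset_trans N'N NW) rtW.
have dt0 : dif (rf N' t) = 0.
  have := congr1 (resf N'N) a0; rewrite raddf0 resfZ resf_dif res_rf; last first.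
    exact: regular_res NW rtW.
  set a' := regfun_res N'N a => e.
  have ra' : regular N' (rfun a') by case: (regfunP a').
  have a'n0 z : oset N' z -> rfun a' z != 0.
    by move=> N'z; rewrite regfun_resE //; case: N'z.
  have -> : dif (rf N' t) = (rf N' (fun z => (rfun a' z)^-1) * a') *: dif (rf N' t).
    rewrite [X in X *: _](_ : _ = 1) ?scale1r //; apply: regfun_eq => z N'z.
    by rewrite rfunM rfE ?rfun1 ?mulVf //; [exact: a'n0|exact: regular_inv].
  by rewrite -scalerA e scaler0.
have [_ [T0y N0y]] := NW y Ny; have U0y : oset U0 y by case: (NW y Ny).
have [t' lp'] := lpX y; have [M [My rt'M]] := lp_regular lp'.
have spt' : spanned y (fun _ : 'I_1 => t) (dif (rf M t')).
  have := form_spanned_coord ch (dif (rf M t')) My U0y.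
  apply: spanned_trans => [_|i V' V'y rV']; first by exists T0.
  have [_ _ rtV [c rc e]] := VP i; have V0y := N0V y N0y i.
  apply/(spanned_res _ (opensIl V' (V i))) => //; rewrite resf_dif res_rf //.
  exists (opensI V' (V i)), (@subset_refl _ _), (fun=> c); split=> //.
  - by move=> _; apply: regular_res rtV; exact: opensIr.
  - by move=> _; apply: regular_res rc; exact: opensIr.
  have := congr1 (resf (opensIr V' (V i))) e.
  have rco : regular (V i) (coord i).
    by have [_ VU0 _ _] := VP i; exact: (coord_regular ch i VU0).
  rewrite resfZ !resf_dif !res_rf //.
    by move=> e'; rewrite big_ord1.
  exact: regular_res (opensIr _ _) rco.
have [V' [h [c [V'y rt rc e]]]] := spt'.
pose L := opensI V' N'; have LM : L `<=` M := subset_trans (opensIl V' N') h.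
apply: (dif_lp_neq0 (Om := Om) lp' (V := L)) => //.
  exact: regular_res LM rt'M.
rewrite -(res_rf LM rt'M) -resf_dif -(resf_resf h (opensIl V' N') LM) e.
rewrite res_comb // big_ord1 -(res_rf (opensIr V' N') rt') -resf_dif dt0.
by rewrite raddf0 scaler0.
Qed.
End Spanning.

(** * Residues *)

Section Curve.
Variables (K : closedFieldType) (X : prevariety K) (Om : kahler X).
Hypothesis K0 : [pchar K] =i pred0.
Hypothesis irr : forall U : opens X, oset U !=set0 -> dense U.
Hypothesis lpX : forall x : X, exists t, local_parameter x t.
Implicit Types (U V W N : opens X) (x y : X) (t f : X -> K).

Local Notation forms := (forms Om).
Local Notation dif := (dif Om).

Lemma opens_meet U V : oset U !=set0 -> oset V !=set0 -> oset (opensI U V) !=set0.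
Proof.
move=> U0 V0; have [y [Vy Uy]] := irr U0 V0 (oset_open V).
by exists y.
Qed.

Lemma regular_torsion_free : torsion_free (regular_sheaf X).
Proof.
move=> U V h s V0 s0; apply: regfun_eq => y Uy; rewrite rfun0.
apply: contrapT => /eqP sy; have [rs _] := regfunP s.
have [z [[Uz sz] Vz]] := opens_meet (U := opens_nz rs) (ex_intro _ y (conj Uy sy)) V0.
have := congr1 (fun a => rfun a z) s0.
by rewrite /= regfun_resE // rfun0; apply/eqP.
Qed.

(** Near each point s = c dt with dt free, which reduces the question to c: the open set c != 0, if
    nonempty, would meet V. *)
Lemma forms_torsion_free : torsion_free Om.
Proof.
move=> U V h s V0 s0; apply: sheaf_eq => x Ux; have [t lp] := lpX x.
have [W [Wx rt Wfree]] := dif_lp_free Om lpX lp.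
have [M [k [c [Mx rtM rc e]]]] := form_lp (s : forms U) lp Ux.
pose N := opensI M W; have NM : N `<=` M := opensIl M W.
have NU : N `<=` U := subset_trans NM k.
exists N, NU; split=> //; rewrite linear0.
have rcN := regular_res NM rc; have rtN := regular_res (opensIr M W) rt.
have sN : resf NU s = rf N c *: dif (rf N t).
  by rewrite -(resf_resf k NM NU) e resfZ resf_dif !res_rf.
rewrite -[LHS]/(resf NU s) sN.
suff -> : rf N c = 0 by rewrite scale0r.
apply: regfun_eq => y Ny; rewrite rfun0; apply: contrapT => /eqP cy.
have [rc' _] := regfunP (rf N c).
have [z [[Nz cz] Vz]] := opens_meet (U := opens_nz rc') (ex_intro _ y (conj Ny cy)) V0.
pose L := opensI (opens_nz rc') V.
have LN : L `<=` N by move=> z' [[]].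
have LV : L `<=` V by move=> z' [].
have Lz : oset L z by [].
have : regfun_res LN (rf N c) *: dif (rf L t) = 0.
  rewrite -(res_rf LN rtN) -resf_dif -resfZ -sN (resf_resf NU LN (subset_trans LN NU)).
  by rewrite -(resf_resf h LV) [resf h s]s0 raddf0.
move=> /(Wfree L (subset_trans LN (opensIr M W)))/(congr1 (fun a => rfun a z)).
by rewrite rfun0 regfun_resE //; apply/eqP.
Qed.

Lemma lp_nz_nonempty x t U (rt : regular U t) : local_parameter x t -> oset U x ->
  oset (opens_nz rt) !=set0.
Proof.
move=> lp Ux; apply: contrapT => h; apply: (lp_not_near0 lp).
apply: filterS (opens_near Ux) => y Uy; apply: contrapT => /eqP ty.
by apply: h; exists y.
Qed.

Lemma rat_ext U (dU : dense U) V (dV : dense V) N (f : regfun U) (g : regfun V) :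
  N `<=` U -> N `<=` V -> oset N !=set0 -> (forall y, oset N y -> rfun f y = rfun g y) ->
  rat (F := regular_sheaf X) dU f = rat (F := regular_sheaf X) dV g.
Proof.
move=> NU NV N0 fg; apply: (rat_eq dU dV (h := NU) (k := NV) (irr N0)).
by apply: regfun_eq => y Ny; rewrite /= !regfun_resE // fg.
Qed.

(* k is the order of the pole of g at x. *)
Lemma rational_lp (g : function_field X) x t U : local_parameter x t -> oset U x ->
  exists k v W, [/\ oset W x, W `<=` U, regular W t, regular W v & (k = 0%N \/ v x != 0) /\
    forall N (dN : dense N), N `<=` W -> (forall y, oset N y -> t y != 0) ->
      g = rat (F := regular_sheaf X) dN (rf N (fun y => v y / t y ^+ k))].
Proof.
move=> lp Ux; have [U1 [dU1 [s ->]]] := ratE g.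
have X0 : [set: X] !=set0 by exists x.
have [U0 [n [phi [U0x _ ch]]]] := chart_at x.
have [y [U1y U0y]] := opens_meet (dense_neq0 X0 dU1) (ex_intro _ x U0x).
have rsy : regular_at y (rfun s) by exists U1; split=> //; case: (regfunP s).
(* The fraction represents g near y, but p and q are polynomials on the chart around x, so P and Q
   are regular at x too. *)
have /(chart_frac ch _ U0y)[p [q /near_opens[M [My ME]]]] := rsy.
pose P z := meval (phi z) p; pose Q z := meval (phi z) q.
have rP : regular_at x P by exact: chart_poly ch _ _ _.
have rQ : regular_at x Q by exact: chart_poly ch _ _ _.
have [/near_opens[N [Nx NE]]|[l [u [ru ux QE]]]] := lp_factor lp rQ.
  have [z [Mz Nz]] := opens_meet (ex_intro _ y My) (ex_intro _ x Nx).
  by have [] := ME z Mz; rewrite -/(Q z) NE // eqxx.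
pose v0 z := P z * (u z)^-1.
have rv0 : regular_at x v0 by apply: regular_atM => //; exact: regular_atV.
(* Cancels the common power of t in v0 / t^l, so that v x != 0 unless k = 0. *)
have [k [v [rv kv vE]]] : exists k v, [/\ regular_at x v, (k = 0%N \/ v x != 0) &
    \forall z \near x, v0 z * t z ^+ k = v z * t z ^+ l].
  have [v00|[m [v1 [rv1 v1x v0E]]]] := lp_factor lp rv0.
    exists 0%N, (fun=> 0); split; [exact: regular_at_cst|by left|].
    by apply: filterS v00 => z ->; rewrite !mul0r.
  have [lm|ml] := leqP l m.
    exists 0%N, (fun z => v1 z * t z ^+ (m - l)); split; [|by left|].
      by apply: regular_atM => //; apply/regular_atX/lp_regular/lp.
    by apply: filterS v0E => z ->; rewrite expr0 mulr1 -mulrA -exprD subnK.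
  exists (l - m)%N, v1; split=> //; first by right.
  by apply: filterS v0E => z ->; rewrite -mulrA -exprD subnKC // ltnW.
have [T [Tx rt]] := lp_regular lp; have [V [Vx rvV]] := rv.
have /near_opens[W0 [W0x W0E]] : \forall z \near x,
    [/\ Q z = u z * t z ^+ l, v0 z * t z ^+ k = v z * t z ^+ l & u z != 0].
  by apply: filterS3 QE vE (regular_at_nz_near ru ux) => z.
pose W := opensI (opensI U T) (opensI V W0).
exists k, v, W; split=> //.
- by move=> z [[]].
- by apply: regular_res rt => z [[]].
- by apply: regular_res rvV => z [_ []].
split=> // N dN NW tN0.
have rtN : regular N t by apply: regular_res rt => z /NW [[]].
have rvN : regular N v by apply: regular_res rvV => z /NW [_ []].
have rN : regular N (fun z => v z / t z ^+ k).
  apply: regularM => //; apply: regular_inv; first exact: regularX.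
  by move=> z Nz; rewrite expf_neq0 // tN0.
have L0 := opens_meet (dense_neq0 X0 dN) (opens_meet (dense_neq0 X0 dU1) (ex_intro _ y My)).
apply: (@rat_ext _ _ _ _ (opensI N (opensI U1 M))) => //.
- by move=> z [_ []].
- by move=> z [].
move=> z [Nz [U1z Mz]]; rewrite rfE //; have [_ [_ W0z]] := NW z Nz.
have [Qz vz uz] := W0E z W0z; have [qz ->] := ME z Mz; have tz := tN0 z Nz.
rewrite -/(P z) -/(Q z) Qz; apply: (mulIf (expf_neq0 k tz)); rewrite divfK ?expf_neq0 //.
apply: (mulIf (expf_neq0 l tz)); rewrite -vz /v0.
by field; rewrite uz expf_neq0.
Qed.

Lemma rfunX V (a : regfun V) k y : oset V y -> rfun (a ^+ k) y = rfun a y ^+ k.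
Proof.
move=> Vy; elim: k => [|k IH]; first by rewrite !expr0 rfun1.
by rewrite !exprS rfunM IH.
Qed.

Lemma rfunMn V (a : regfun V) k y : rfun (a *+ k) y = rfun a y *+ k.
Proof. by elim: k => [|k IH]; rewrite ?mulr0n ?rfun0 // !mulrS rfunD IH. Qed.

(* A pole of order k > 0 of g gives a pole of order k + 1 of dg, since k != 0 in K. *)
Lemma regular_of_dif_at U (dU : dense U) (g : function_field X) (w : Om U) x :
  oset U x -> rat_map (kd Om) g = rat dU w ->
  exists V (dV : dense V) (s : regular_sheaf X V), oset V x /\ g = rat dV s.
Proof.
move=> Ux ew; have [t lp] := lpX x; have X0 : [set: X] !=set0 by exists x.
have [W0 [W0x _ free]] := dif_lp_free Om lpX lp.
have [M [hM [c [Mx rtM rc ewM]]]] := form_lp (w : forms U) lp Ux.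
have [k [v [W [Wx WMW0 rt rv [kv gE]]]]] := rational_lp g lp (conj Mx W0x : oset (opensI M W0) x).
have dW : dense W by apply: irr; exists x.
pose N := opens_nz rt; have NW : N `<=` W by move=> y [].
have N0 : oset N !=set0 := lp_nz_nonempty rt lp Wx.
have dN := irr N0.
have gN := gE N dN NW (fun y (h : oset N y) => h.2).
case: k => [|k] in kv gE gN.
  exists W, dW, (rf W v); split=> //; rewrite gN.
  apply: (@rat_ext _ _ _ _ N) => // y Ny; rewrite !rfE //.
  - by rewrite expr0 divr1.
  - exact: NW.
  - apply: regular_ext (regular_res NW rv) => z _; by rewrite expr0 divr1.
have {kv} vx : v x != 0 by case: kv.
have [M2 [hM2 [c2 [M2x rtM2 rc2 ev]]]] := form_lp (dif (rf W v)) lp Wx.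
pose L := opensI N M2; have LN : L `<=` N := opensIl N M2.
have LM2 : L `<=` M2 := opensIr N M2.
have LW : L `<=` W := subset_trans LM2 hM2.
have M2M : M2 `<=` M by move=> y /hM2 /WMW0 [].
have LM : L `<=` M := subset_trans LM2 M2M.
have LU : L `<=` U := subset_trans LM hM.
have LW0 : L `<=` W0 by move=> y /LW /WMW0 [].
have L0 : oset L !=set0 by apply: opens_meet => //; exists x.
have dL := irr L0.
have tL y : oset L y -> t y != 0 by move=> /LN [].
have rtL := regular_res LW rt; have rvL := regular_res LW rv.
pose F := rf L (fun y => v y / t y ^+ k.+1); pose T := rf L t; pose D := dif T.
have rFL : regular L (fun y => v y / t y ^+ k.+1).
  apply: regularM => //; apply: regular_inv; first exact: regularX.
  by move=> z Lz; rewrite expf_neq0 // tL.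
have FT : F * T ^+ k.+1 = rf L v.
  apply: regfun_eq => y Ly; rewrite rfunM rfunX // !rfE //.
  by rewrite divfK // expf_neq0 // tL.
have dF : dif F = rf L c *: D.
  have := ew; rewrite (gE L dL LW tL) rat_mapE -(rat_res dU dL LU).
  move=> /(rat_inj X0 forms_torsion_free) => eF.
  rewrite -[LHS]/(kd Om L F) eF -[LHS]/(resf LU w).
  by rewrite -(resf_resf hM LM LU) ewM resfZ resf_dif !res_rf.
have dvL : dif (rf L v) = rf L c2 *: D.
  have := congr1 (resf LM2) ev.
  by rewrite (resf_resf hM2 LM2 LW) resfZ !resf_dif !res_rf.
have e0 : (F * (T ^+ k *+ k.+1) + T ^+ k.+1 * rf L c - rf L c2) *: D = 0.
  by rewrite scalerBl scalerDl -!scalerA -difX -dF -difM FT dvL subrr.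
(* The coefficient in [e0] times t, rewritten without denominators so as to be regular at x. It
   vanishes on L, hence on M2, and its value at x is (k + 1) v x. *)
pose G y := k.+1%:R * v y + t y ^+ k.+2 * c y - t y * c2 y.
have rvM2 := regular_res hM2 rv; have rcM2 := regular_res M2M rc.
have rG : regular M2 G.
  apply: regularB; last exact: regularM.
  apply: regularD; first by apply: regularM => //; exact: regular_cst.
  by apply: regularM => //; exact: regularX.
have : rf M2 G = 0.
  apply: (regular_torsion_free (h := LM2) L0).
  rewrite [LHS](res_rf LM2 rG); apply: regfun_eq => y Ly.
  have Ny : oset M2 y := LM2 y Ly.
  have /(congr1 (fun a => rfun a y * t y)) := free L LW0 _ e0.
  rewrite /= rfE ?rfun0 ?mul0r; [|exact: regular_res rG|by []].
  rewrite rfunB !(rfunD, rfunM, rfunMn, rfunX) // !rfE //; try exact: regular_res LM2 _.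
  move=> <-; rewrite /G !exprS -mulr_natl; by field; rewrite ?expf_neq0 ?tL.
move=> /(congr1 (fun a => rfun a x)); rewrite rfun0 rfE // /G (lp_0 lp).
rewrite exprS !mul0r subr0 addr0 => /eqP; rewrite mulf_eq0 (negbTE vx) orbF.
by have /pcharf0P -> := K0.
Qed.

Lemma regular_of_dif U (dU : dense U) (g : function_field X) (w : Om U) :
  [set: X] !=set0 -> rat_map (kd Om) g = rat dU w ->
  exists s : regular_sheaf X U, g = rat dU s.
Proof.
move=> X0 ew; pose R V (s : regular_sheaf X V) := exists dV : dense V, g = rat dV s.
have Rex x : oset U x -> exists V (s : regular_sheaf X V), [/\ V `<=` U, oset V x & R V s].
  move=> Ux; have [V [dV [s [Vx es]]]] := regular_of_dif_at Ux ew.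
  exists (opensI U V), (res (opensIr U V) s).
  split; [exact: opensIl|by []|exists (opensI_dense dU dV)].
  by rewrite es rat_res.
have [//||s sP] := @sheaf_glue_rel _ _ (regular_sheaf X) U R.
  move=> V V' s s' _ _ [dV es] [dV' es'].
  apply: (rat_inj (dU := opensI_dense dV dV') X0 regular_torsion_free).
  by rewrite !rat_res -es es'.
exists s; have [x Ux] := dense_neq0 X0 dU; have [V [s' [VU Vx Rs']]] := Rex x Ux.
have es := sP V VU s' Rs'; case: Rs' => dV ->.
by rewrite -es rat_res.
Qed.

(** * Polar parts and their primitives *)

Lemma antiderivative (p : {poly K}) : p`_1 = 0 ->
  exists q : {poly K}, p = (p`_0)%:P - 'X^2 * q^`().
Proof.
(* With X = 1/t one has d (q (1/t)) = - X^2 q' dt, and t^-(j+1) dt has the primitive - t^-j / j; j =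
   0 is the residue term, absent by [p1]. *)
move=> p1; exists (\poly_(j < size p) (if j == 0%N then 0 else - p`_j.+1 / j%:R)).
apply/polyP => i; rewrite coefB coefC coefXnM; case: i => [|[|i]] /=.
- by rewrite subr0.
- by rewrite p1 subr0.
rewrite subn2 /= coef_deriv coef_poly sub0r; case: ltnP => [_|pi]; last first.
  by rewrite mul0rn oppr0 nth_default // ltnW.
by rewrite -[_ *+ _]mulr_natr divfK ?opprK //; have /pcharf0P -> := K0.
Qed.

(** Dividing v - v x by t repeatedly: v / t^(k+1) = v x / t^(k+1) + u / t^k. *)
Lemma polar_part x t v k : local_parameter x t -> regular_at x v ->
  exists (q : {poly K}) r, regular_at x r /\
    \forall y \near x, t y != 0 -> v y / t y ^+ k = q.[(t y)^-1] + r y.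
Proof.
move=> lp; elim: k v => [|k IH] v rv.
  by exists 0, v; split=> //; apply: nearW => y _; rewrite expr0 divr1 horner0 add0r.
have [|u ru vE] := @lp_divide _ _ x t lp (fun y => v y - v x).
  by split; [apply: regular_atB => //; exact: regular_at_cst|rewrite subrr].
have [q [r [rr qE]]] := IH u ru.
exists (v x *: 'X^(k.+1) + q), r; split=> //.
apply: filterS2 vE qE => y vE qE ty; rewrite hornerD hornerZ hornerXn -addrA -qE //.
have -> : v y = v x + u y * t y by rewrite -vE addrC subrK.
by rewrite exprVn !exprS; field; rewrite ty expf_neq0.
Qed.

Lemma regular_horner U f (q : {poly K}) : regular U f -> regular U (fun y => q.[f y]).
Proof.
move=> rf; elim/poly_ind: q => [|q c IH].
  by apply: regular_ext (regular_cst U 0) => y _; rewrite horner0.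
apply: regular_ext (regularD (regularM IH rf) (regular_cst U c)) => y _.
by rewrite hornerMXaddC.
Qed.

Lemma dif_horner U f (q : {poly K}) : regular U f ->
  dif (rf U (fun y => q.[f y])) = rf U (fun y => q^`().[f y]) *: dif (rf U f).
Proof.
move=> r; elim/poly_ind: q => [|q c IH].
  rewrite (rf_eq (g := fun=> 0)); [|exact: regular_horner|by move=> y _; rewrite horner0].
  rewrite [X in X *: _](_ : _ = 0) ?scale0r ?dif_cst //.
  apply: regfun_eq => y Uy; rewrite rfun0 rfE ?deriv0 ?horner0 //.
  by apply: regular_ext (regular_cst U 0) => z _; rewrite horner0.
have rq := regular_horner q r; have rq' := regular_horner q^`() r.
have -> : rf U (fun y => (q * 'X + c%:P).[f y]) =
    rf U (fun y => q.[f y]) * rf U f + rf U (fun=> c).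
  apply: regfun_eq => y Uy; rewrite rfunD rfunM !rfE ?hornerMXaddC //.
    exact: regular_cst.
  exact: regular_horner.
rewrite difD dif_cst addr0 difM IH scalerA -scalerDl; congr (_ *: _).
apply: regfun_eq => y Uy; rewrite rfunD rfunM !rfE //; last exact: regular_horner.
by rewrite derivD derivM derivX derivC addr0 mulr1 hornerD hornerMX addrC [f y * _]mulrC.
Qed.

Lemma dif_horner_inv U t (q : {poly K}) : regular U t -> (forall y, oset U y -> t y != 0) ->
  dif (rf U (fun y => q.[(t y)^-1])) =
  rf U (fun y => - ('X^2 * q^`()).[(t y)^-1]) *: dif (rf U t).
Proof.
move=> rt tn0; have rt' := regular_inv rt tn0.
have TT : rf U t * rf U (fun y => (t y)^-1) = 1.
  by apply: regfun_eq => y Uy; rewrite rfunM !rfE // rfun1 // divff // tn0.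
set T := rf U t in TT *; set T' := rf U (fun y => (t y)^-1) in TT *.
have dT' : dif T' = - (T' ^+ 2) *: dif T.
  have := dif1 Om U; rewrite -TT difM => /eqP; rewrite addr_eq0 => /eqP.
  move=> /(congr1 (fun w => T' *: w)); rewrite scalerA [T' * T]mulrC TT scale1r => ->.
  by rewrite scalerN scalerA scaleNr expr2.
rewrite dif_horner // dT' scalerA; congr (_ *: _).
have rq := regular_horner q^`() rt'; have rXq := regular_horner ('X^2 * q^`()) rt'.
apply: regfun_eq => y Uy.
rewrite rfunM -[- (T' ^+ 2)]scaleN1r rfunZ rfunX // !rfE //; last first.
  by apply: regular_ext (regularM (regular_cst U (-1)) rXq) => z _; rewrite mulN1r.
by rewrite hornerM hornerXn; ring.
Qed.

Lemma dnbhs_opens x W : x^' (oset W) ->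
  exists U, oset U x /\ forall y, oset U y -> y <> x -> oset W y.
Proof.
rewrite /dnbhs /within /= => /near_opens[U [Ux UW]]; exists U; split=> // y Uy yx.
by apply: UW => //; apply/eqP.
Qed.

Lemma second_kind_locally_exact (w : ratsec Om) : smem (second_kind Om) w ->
  locally_form_exact w.
Proof.
move=> sw x; have [t lp] := lpX x; have [W [s [T [h [p [g []]]]]]] := sw x t lp.
move=> /dnbhs_opens[N0 [N0x N0W]] [V [dV [s' [WV [ew es]]]]] Th [N1 [N1x rg]] [sE p1].
have [N2 [N2x rt]] := lp_regular lp.
pose U := opensI N0 (opensI N1 N2).
have Ux : oset U x by [].
have rtU : regular U t by apply: regular_res rt => y [_ []].
have rgU : regular U g by apply: regular_res rg => y [_ []].
pose N := opens_nz rtU; have N0' : oset N !=set0 := lp_nz_nonempty rtU lp Ux.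
have dN := irr N0'; have dU : dense U by apply: irr; exists x.
have NU : N `<=` U by move=> y [].
have tN y : oset N y -> t y != 0 by case.
have NW : N `<=` W.
  move=> y Ny; apply: N0W; first by case: (NU y Ny).
  by move=> yx; have := tN y Ny; rewrite yx (lp_0 lp) eqxx.
have rtN := regular_res NU rtU; have rgN := regular_res NU rgU.
have [q pE] := antiderivative (esym p1).
(* As p = p_0 - X^2 q', the form d (q (1/t)) carries the whole pole of w, and (p_0 + g) dt
   remains. *)
pose u := rf U (fun y => p`_0 + g y) *: dif (rf U t).
exists U, dU, u, (rat (F := regular_sheaf X) dN (rf N (fun y => q.[(t y)^-1]))).
split=> //; rewrite rat_mapE -[kd Om N _]/(dif _) dif_horner_inv //.
rewrite -(rat_res dU dN NU) -[res NU u]/(resf NU u) resfZ resf_dif.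
have rpg : regular U (fun y => p`_0 + g y) by apply: regularD => //; exact: regular_cst.
rewrite !res_rf // ratD.
transitivity (@rat K X Om N dN ((rf N (fun y => p`_0 + g y) +
    rf N (fun y => - ('X^2 * q^`()).[(t y)^-1])) *: dif (rf N t))); last first.
  by congr (rat dN _); exact: kactDl.
rewrite ew -(rat_res dV dN (subset_trans NW WV)).
rewrite -(res_res WV NW (subset_trans NW WV)) es sE -[res NW _]/(resf NW (h *: dif T)).
rewrite resfZ resf_dif.
have -> : regfun_res NW T = rf N t.
  by apply: regfun_eq => y Ny; rewrite regfun_resE // rfE //; case: (Th y (NW y Ny)).
suff -> : regfun_res NW h =
    rf N (fun y => p`_0 + g y) + rf N (fun y => - ('X^2 * q^`()).[(t y)^-1]).
  reflexivity.
apply: regfun_eq => y Ny; rewrite regfun_resE // rfunD.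
have rXq : regular N (fun y => - ('X^2 * q^`()).[(t y)^-1]).
  apply: regular_ext (regularM (regular_cst N (-1))
    (regular_horner ('X^2 * q^`()) (regular_inv rtN tN))) => z _.
  by rewrite mulN1r.
rewrite !rfE //; last exact: regular_res rpg.
have [_ ->] := Th y (NW y Ny).
rewrite {1}pE hornerD hornerN hornerC; ring.
Qed.

Lemma locally_exact_second_kind (w : ratsec Om) : locally_form_exact w ->
  smem (second_kind Om) w.
Proof.
move=> lw x t lp; have [U [dU [u [f [Ux ew]]]]] := lw x.
have [V [hV [c [Vx rtV rc uE]]]] := form_lp (u : forms U) lp Ux.
have [k [v [W [Wx WV rtW rv [_ fE]]]]] := rational_lp f lp Vx.
have [|q [r [[R [Rx rr]] /near_opens[N0 [N0x qE]]]]] := polar_part k lp (v := v).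
  by exists W.
have [M [hM [c2 [Mx rtM rc2 rE]]]] := form_lp (dif (rf R r)) lp Rx.
(* Shrinking to N1 makes the locus t != 0 in L a full punctured neighbourhood of x, as [has_residue]
   demands. *)
have /near_opens[N1 [N1x tx]] := lp_isolated_zero lp.
pose L := opensI (opensI W M) (opensI N0 N1).
have LW : L `<=` W by move=> y [[]].
have LM : L `<=` M by move=> y [[]].
have LV := subset_trans LW WV; have LU := subset_trans LV hV.
have Lx : oset L x by [].
have rtL := regular_res LW rtW.
pose N := opens_nz rtL; have NL : N `<=` L by move=> y [].
have dN := irr (lp_nz_nonempty rtL lp Lx).
have NW := subset_trans NL LW; have NM := subset_trans NL LM.
have NV := subset_trans NL LV; have NU := subset_trans NL LU.
have tN y : oset N y -> t y != 0 by case.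
have rtN := regular_res NL rtL.
have rcN := regular_res NV rc; have rc2N := regular_res NM rc2.
have NR := subset_trans NM hM; have rrN := regular_res NR rr.
(* The polar part of df; the factor 'X^2 excludes a term of degree 1, so the residue is 0. *)
pose P : {poly K} := - ('X^2 * q^`()).
have rPN : regular N (fun y => P.[(t y)^-1]) := regular_horner P (regular_inv rtN tN).
pose h := rf N (fun y => P.[(t y)^-1] + (c2 y + c y)).
have rcc := regularD rc2N rcN.
have dfN : dif (rf N (fun y => v y / t y ^+ k)) =
    rf N (fun y => P.[(t y)^-1] + c2 y) *: dif (rf N t).
  have -> : rf N (fun y => v y / t y ^+ k) = rf N (fun y => q.[(t y)^-1]) + rf N r.
    have rq := regular_horner q (regular_inv rtN tN).
    rewrite -rfD //; symmetry; apply: rf_eq; first exact: regularD.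
    by move=> y Ny; have [_ [N0y _]] := NL y Ny; rewrite qE // tN.
  rewrite difD dif_horner_inv // rfD // scalerDl; congr (_ *: _ + _).
    by apply: rf_eq => [|y _]; [apply: regular_ext rPN => y _|]; rewrite hornerN.
  have := congr1 (resf NM) rE.
  by rewrite (resf_resf hM NM NR) resfZ !resf_dif !res_rf.
exists N, (h *: dif (rf N t)), (rf N t), h, P, (fun y => c2 y + c y); split.
- rewrite /dnbhs /within /=; apply/near_opens; exists L; split=> // y Ly yx.
  split=> //=; apply/eqP => ty; have [_ [_ N1y]] := Ly.
  by move/eqP: yx; apply; exact: tx.
- exists N, dN, (h *: dif (rf N t)), (@subset_refl _ _); rewrite res_id; split=> //.
  rewrite ew (fE N dN NW tN) rat_mapE -(rat_res dU dN NU) ratD.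
  congr (rat dN _); rewrite -[kd Om N _]/(dif _) dfN.
  rewrite -[res NU u]/(resf NU u) -(resf_resf hV NV NU) uE resfZ resf_dif.
  rewrite !res_rf //; apply: etrans (esym (kactDl _ _ _)) _.
  suff -> : h = rf N c + rf N (fun y => P.[(t y)^-1] + c2 y) by [].
  by rewrite /h !rfD // addrA addrC.
- by move=> y Ny; rewrite !rfE //; exact: regularD.
- apply: regular_atD; first by exists M.
  by exists V.
- by split=> //; rewrite coefN coefXnM oppr0.
Qed.
End Curve.

Theorem theoremA1 (K : closedFieldType) (K0 : [pchar K] =i pred0)
    (X : prevariety K) (X_curve : smooth_complete_curve X)
    (X_connected : connected [set: X])
    (Om : kahler X) (I : injective_resolution (de_rham Om)) :
  exists phi : {linear subquot (second_kind Om) (exact_forms Om) ->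
                       hypercohomology I 1%N},
    bijective phi.
Proof.
have [[_ [[Z [Zirr _]] _] lpX] _] := X_curve.
have X0 : [set: X] !=set0 by have [_ [[x _] _]] := Zirr 0%N isT; exists x.
have irr := connected_smooth_irreducible X_connected lpX.
apply: second_kind_hypercohomology => //.
- exact: regular_torsion_free.
- exact: forms_torsion_free.
- by move=> U dU g w; exact: regular_of_dif.
- move=> w; split; first exact: second_kind_locally_exact.
  exact: locally_exact_second_kind.
Qed.
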